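(* Let $d\ge 1$, $D=d+1$, and let $\{\alpha(\mathbf k)\}_{\mathbf k\in\mathbb R^d}$ be a family of matching matrices. Then the following are equivalent: (1) $\alpha$ is equivariantly null-homotopic; (2) $\alpha$ admits a multi-step logarithm; (3) there exists a map $\beta:\mathbb R^D\to U(m)$, $(k_1,\mathbf k)\mapsto\beta(k_1,\mathbf k)$, such that (a) $\beta$ is continuous; (b) for each fixed $k_1\in\mathbb R$, $\mathbf k\mapsto\beta(k_1,\mathbf k)$ is $\mathbb Z^d$-periodic; (c) $\beta(-k_1,-\mathbf k)=\varepsilon^{-1}\,\overline{\beta(k_1,\mathbf k)}\,\varepsilon$ for all $(k_1,\mathbf k)\in\mathbb R^D$ (bar denotes entrywise complex conjugation); (d) $\alpha(\mathbf k)=\beta(k_1,\mathbf k)\,\beta(k_1+1,\mathbf k)^{-1}$ for all $(k_1,\mathbf k)\in\mathbb R^D$.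
   Context: Fix $m\ge1$. Let $\varepsilon$ denote either the $m\times m$ identity matrix $\mathbf 1$ (bosonic case) or, when $m$ is even, the standard symplectic matrix $J=\begin{pmatrix}0&\mathbf 1\\-\mathbf 1&0\end{pmatrix}$ (fermionic case). A family of matching matrices is a map $\alpha:\mathbb R^d\to U(m)$ which is continuous, $\mathbb Z^d$-periodic ($\alpha(\mathbf k+\mathbf n)=\alpha(\mathbf k)$ for $\mathbf n\in\mathbb Z^d$) and time-reversal symmetric: $\varepsilon\,\alpha(\mathbf k)=\alpha(-\mathbf k)^t\,\varepsilon$ for all $\mathbf k$ ($t$ = transpose). Two families of matching matrices $\alpha_0,\alpha_1$ are equivariantly homotopic if there is a map $(t,\mathbf k)\mapsto\alpha_t(\mathbf k)$, continuous in $t\in[0,1]$, such that for each fixed $t$ the map $\alpha_t$ is a family of matching matrices, and $\alpha_{t=0}=\alpha_0$, $\alpha_{t=1}=\alpha_1$. A family is equivariantly null-homotopic if it is equivariantly homotopic to the constant family $\mathbf k\mapsto\mathbf 1$. A family of matching matrices $\alpha$ admits a multi-step logarithm if there are $M\in\mathbb N$ and maps $h_1,\dots,h_M:\mathbb R^d\to M_m(\mathbb C)$ such that each $h_\ell(\mathbf k)$ is self-adjoint, each $h_\ell$ is continuous, $\mathbb Z^d$-periodic, and satisfies $\varepsilon\,h_\ell(\mathbf k)=h_\ell(-\mathbf k)^t\,\varepsilon$, and for all $\mathbf k$: $\alpha(\mathbf k)=e^{ih_M(\mathbf k)/2}\cdots e^{ih_2(\mathbf k)/2}\,e^{ih_1(\mathbf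 k)}\,e^{ih_2(\mathbf k)/2}\cdots e^{ih_M(\mathbf k)/2}$. *)

(* Defs.v *)
From mathcomp Require Import all_boot.
From Stdlib Require Import Reals ZArith ClassicalEpsilon.

Set Implicit Arguments.
Unset Strict Implicit.
Unset Printing Implicit Defensive.

Open Scope R_scope.

Definition C := (R * R)%type.
Definition C0 : C := (0, 0).
Definition C1 : C := (1, 0).
Definition Ci : C := (0, 1).
Definition RtoC (r : R) : C := (r, 0).
Definition Cadd (x y : C) : C := (fst x + fst y, snd x + snd y).
Definition Copp (x : C) : C := (- fst x, - snd x).
Definition Cmul (x y : C) : C :=
  (fst x * fst y - snd x * snd y, fst x * snd y + snd x * fst y).
Definition Cconj (x : C) : C := (fst x, - snd x).
Definition Cnorm (x : C) : R := sqrt (fst x ^ 2 + snd x ^ 2).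

Definition Mat (m : nat) := 'I_m -> 'I_m -> C.

Definition mid (m : nat) : Mat m := fun i j => if i == j then C1 else C0.
Definition mzero (m : nat) : Mat m := fun _ _ => C0.
Arguments mid : clear implicits.
Arguments mzero : clear implicits.
Definition madd (m : nat) (A B : Mat m) : Mat m := fun i j => Cadd (A i j) (B i j).
Definition mscale (m : nat) (c : C) (A : Mat m) : Mat m := fun i j => Cmul c (A i j).
Definition mmul (m : nat) (A B : Mat m) : Mat m :=
  fun i j => \big[Cadd/C0]_(k < m) Cmul (A i k) (B k j).
Definition mtr (m : nat) (A : Mat m) : Mat m := fun i j => A j i.
Definition mconj (m : nat) (A : Mat m) : Mat m := fun i j => Cconj (A i j).
Definition madj (m : nat) (A : Mat m) : Mat m := mconj (mtr A).

Fixpoint mpow (m : nat) (A : Mat m) (n : nat) : Mat m :=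
  match n with O => mid m | S n' => mmul A (mpow A n') end.

Fixpoint exp_partial (m : nat) (A : Mat m) (n : nat) : Mat m :=
  match n with
  | O => mzero m
  | S n' => madd (exp_partial A n') (mscale (RtoC (/ INR (fact n'))) (mpow A n'))
  end.

Definition is_mexp (m : nat) (A E : Mat m) : Prop :=
  forall eps, 0 < eps -> exists N : nat, forall n : nat, (N <= n)%nat ->
    forall i j, Cnorm (Cadd (exp_partial A n i j) (Copp (E i j))) < eps.

(* matrix exponential e^A (the series converges, so the limit is unique) *)
Definition mexp (m : nat) (A : Mat m) : Mat m :=
  epsilon (inhabits (mzero m)) (fun E => is_mexp A E).

Definition unitary (m : nat) (A : Mat m) : Prop :=
  mmul (madj A) A = mid m /\ mmul A (madj A) = mid m.
Definition selfadj (m : nat) (A : Mat m) : Prop := madj A = A.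

(* standard symplectic matrix J = [[0, 1], [-1, 0]] (blocks of size m/2) *)
Definition Jmat (m : nat) : Mat m := fun i j =>
  let n := Nat.div2 m in
  if Nat.ltb (val i) n then (if Nat.eqb (val j) (val i + n)%nat then C1 else C0)
  else (if Nat.eqb (val j + n)%nat (val i) then Copp C1 else C0).

Arguments Jmat : clear implicits.

(* epsilon: identity (bosonic, fer = false) or J (fermionic, fer = true) *)
Definition epsm (m : nat) (fer : bool) : Mat m := if fer then Jmat m else mid m.
Arguments epsm : clear implicits.
Definition epsinv (m : nat) (fer : bool) : Mat m :=
  if fer then mscale (Copp C1) (Jmat m) else mid m.

Arguments epsinv : clear implicits.

Definition Vec (d : nat) := 'I_d -> R.
Definition vneg (d : nat) (k : Vec d) : Vec d := fun i => - k i.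
Definition vshift (d : nat) (k : Vec d) (n : 'I_d -> Z) : Vec d :=
  fun i => k i + IZR (n i).

Definition mclose (m : nat) (A B : Mat m) (eps : R) : Prop :=
  forall i j, Cnorm (Cadd (A i j) (Copp (B i j))) < eps.

Definition continuous_vm (d m : nat) (f : Vec d -> Mat m) : Prop :=
  forall k eps, 0 < eps -> exists delta, 0 < delta /\
    forall k', (forall i, Rabs (k' i - k i) < delta) -> mclose (f k') (f k) eps.

Definition continuous2 (d m : nat) (P : R -> Prop) (F : R -> Vec d -> Mat m) : Prop :=
  forall t k, P t -> forall eps, 0 < eps -> exists delta, 0 < delta /\
    forall t' k', P t' -> Rabs (t' - t) < delta ->
      (forall i, Rabs (k' i - k i) < delta) -> mclose (F t' k') (F t k) eps.

Definition periodic (d m : nat) (f : Vec d -> Mat m) : Prop :=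
  forall k (n : 'I_d -> Z), f (vshift k n) = f k.

Definition tr_sym (d m : nat) (e : Mat m) (f : Vec d -> Mat m) : Prop :=
  forall k, mmul e (f k) = mmul (mtr (f (vneg k))) e.

Definition matching_family (d m : nat) (fer : bool) (alpha : Vec d -> Mat m) : Prop :=
  continuous_vm alpha /\ periodic alpha /\ (forall k, unitary (alpha k))
  /\ tr_sym (epsm m fer) alpha.

Definition equiv_homotopic (d m : nat) (fer : bool) (a0 a1 : Vec d -> Mat m) : Prop :=
  exists H : R -> Vec d -> Mat m,
    continuous2 (fun t => 0 <= t <= 1) H /\
    (forall t, 0 <= t <= 1 -> matching_family fer (H t)) /\
    (forall k, H 0 k = a0 k) /\ (forall k, H 1 k = a1 k).

Definition equiv_null_homotopic (d m : nat) (fer : bool) (alpha : Vec d -> Mat m) : Prop :=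
  equiv_homotopic fer alpha (fun _ => mid m).

(* msprod h l k = e^{i h_{l}/2} ... e^{i h_1/2} e^{i h_0} e^{i h_1/2} ... e^{i h_l/2}
   (0-indexed: h 0 plays the role of h_1 in the paper) *)
Fixpoint msprod (d m : nat) (h : nat -> Vec d -> Mat m) (l : nat) (k : Vec d) : Mat m :=
  match l with
  | O => mexp (mscale Ci (h O k))
  | S l' => let E := mexp (mscale (0, / 2) (h l k)) in
            mmul E (mmul (msprod h l' k) E)
  end.

Definition admits_multistep_log (d m : nat) (fer : bool) (alpha : Vec d -> Mat m) : Prop :=
  exists (M : nat) (h : nat -> Vec d -> Mat m),
    (forall l, (l <= M)%nat ->
       continuous_vm (h l) /\ periodic (h l) /\ (forall k, selfadj (h l k))
       /\ tr_sym (epsm m fer) (h l)) /\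
    (forall k, alpha k = msprod h M k).

Definition admits_beta (d m : nat) (fer : bool) (alpha : Vec d -> Mat m) : Prop :=
  exists beta : R -> Vec d -> Mat m,
    (forall k1 k, unitary (beta k1 k)) /\
    continuous2 (fun _ => True) beta /\
    (forall k1, periodic (beta k1)) /\
    (forall k1 k, beta (- k1) (vneg k) =
                  mmul (epsinv m fer) (mmul (mconj (beta k1 k)) (epsm m fer))) /\
    (forall k1 k, alpha k = mmul (beta k1 k) (madj (beta (k1 + 1) k))).

(* Main.v *)
(* The cycle (2) => (3) => (1) => (2). Conjugation by epsilon composed with
   k |-> -k and transposition is an anti-automorphism fixing matching families.

   A multi-step logarithm reads alpha = V W, where V and W^-1 are the values at
   s = -1/2 and s = 1/2 of the path s |-> e^{-i s h_M} ... e^{-i s h_1}; this path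
   satisfies (c), and beta(s + n) = alpha^-n beta(s) extends it to all of R.
   Given beta, alpha_s(k) = beta(-s/2, k) beta(s/2, k)^-1 is a homotopy from 1 to
   alpha. Given a homotopy, compactness of [0, 1]^{d+1} yields finitely many time
   steps during which the family moves little; if G0 = V W has a multi-step
   logarithm and G1 is close to G0, then V^-1 G1 W^-1 is a matching family close
   to 1, hence e^{ih} with h an admissible generator, and G1 = V e^{ih} W. The
   symmetries of h come from the uniqueness of small logarithms. *)

From Coquelicot Require Complex Hierarchy Compactness.
From HB Require Import structures.
Require Import Defs.
From mathcomp Require Import all_boot.
From Stdlib Require Import Reals ZArith Factorial Lra Lia.
From Stdlib Require Import FunctionalExtensionality ClassicalEpsilon.
(* Stdlib's Reals shadows the names C and C1. *)
Import Defs.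

Set Implicit Arguments.
Unset Strict Implicit.
Unset Printing Implicit Defensive.

(** The step length must be fixed before the induction along the homotopy starts, while V and W gain
    a factor at every step. Unitarity resolves this: in the entrywise sum norm a unitary m x m
    matrix has norm at most m^2, so passing from G1 - G0 to V^-1 G1 W^-1 - 1 costs at most a factor
    m^4, however many exponentials have accumulated. The new generator is inserted in the middle of
    the product. The symmetric shape serves exactly this: the anti-automorphism exchanges V and W,
    hence preserves V^-1 G1 W^-1. Logarithms come from a contraction instead of spectral theory. Its
    quantitative injectivity yields self-adjointness, periodicity, symmetry and continuity of h
    together, and the law e^A e^B = e^(A+B) is only needed for real multiples of one matrix. The
    extended path is continuous because alpha = V W says precisely that alpha^-1 carries its value
    at -1/2 to its value at 1/2. *)

(** * Complex and real numbers as laws for iterated sums *)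

Lemma C_ring_theory :
  ring_theory C0 C1 Cadd Cmul (fun x y => Cadd x (Copp y)) Copp eq.
Proof.
by split=> *; repeat match goal with x : C |- _ => destruct x end;
  rewrite /Cadd /Cmul /Copp /C0 /C1 /=; congr pair; ring.
Qed.
Add Ring C_ring : C_ring_theory.

Lemma CaddA : associative Cadd. Proof. by move=> x y z; ring. Qed.
Lemma CaddC : commutative Cadd. Proof. by move=> x y; ring. Qed.
Lemma Cadd0 : left_id C0 Cadd. Proof. by move=> x; ring. Qed.
HB.instance Definition _ := Monoid.isComLaw.Build C C0 Cadd CaddA CaddC Cadd0.
Lemma CmulA : associative Cmul. Proof. by move=> x y z; ring. Qed.
Lemma CmulC : commutative Cmul. Proof. by move=> x y; ring. Qed.
Lemma Cmul1 : left_id C1 Cmul. Proof. by move=> x; ring. Qed.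
HB.instance Definition _ := Monoid.isComLaw.Build C C1 Cmul CmulA CmulC Cmul1.
Lemma Cmul0l : left_zero C0 Cmul. Proof. by move=> x; ring. Qed.
Lemma Cmul0r : right_zero C0 Cmul. Proof. by move=> x; ring. Qed.
HB.instance Definition _ := Monoid.isMulLaw.Build C C0 Cmul Cmul0l Cmul0r.
Lemma CmulDl : left_distributive Cmul Cadd. Proof. by move=> x y z; ring. Qed.
Lemma CmulDr : right_distributive Cmul Cadd. Proof. by move=> x y z; ring. Qed.
HB.instance Definition _ := Monoid.isAddLaw.Build C Cmul Cadd CmulDl CmulDr.

Lemma RplusA : associative Rplus. Proof. by move=> x y z; ring. Qed.
Lemma RplusC : commutative Rplus. Proof. by move=> x y; ring. Qed.
Lemma Rplus0 : left_id 0 Rplus. Proof. by move=> x; ring. Qed.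
HB.instance Definition _ := Monoid.isComLaw.Build R 0 Rplus RplusA RplusC Rplus0.
Lemma Rmul0l : left_zero 0 Rmult. Proof. by move=> x; ring. Qed.
Lemma Rmul0r : right_zero 0 Rmult. Proof. by move=> x; ring. Qed.
HB.instance Definition _ := Monoid.isMulLaw.Build R 0 Rmult Rmul0l Rmul0r.
Lemma RmulDl : left_distributive Rmult Rplus. Proof. by move=> x y z; ring. Qed.
Lemma RmulDr : right_distributive Rmult Rplus. Proof. by move=> x y z; ring. Qed.
HB.instance Definition _ := Monoid.isAddLaw.Build R Rmult Rplus RmulDl RmulDr.

(** * The algebra of matrices *)

Definition msub m (A B : Mat m) : Mat m := fun i j => Cadd (A i j) (Copp (B i j)).
Definition rscale m (a : R) : Mat m -> Mat m := mscale (RtoC a).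

Local Notation "A ** B" := (mmul A B) (at level 40, left associativity).
Local Notation "A +m B" := (madd A B) (at level 50, left associativity).
Local Notation "A -m B" := (msub A B) (at level 50, left associativity).

Lemma mat_ext m (A B : Mat m) : (forall i j, A i j = B i j) -> A = B.
Proof.
move=> h; apply: functional_extensionality => i.
by apply: functional_extensionality => j.
Qed.

Ltac entrywise :=
  apply: mat_ext => ? ?;
  rewrite /madj /madd /msub /rscale /mscale /mzero /mtr /mconj;
  rewrite /RtoC /Ci /Cconj /Cadd /Cmul /Copp /C0 /=; try (congr pair; ring).

Lemma maddA m : associative (@madd m). Proof. by move=> A B D; entrywise. Qed.
Lemma maddC m : commutative (@madd m). Proof. by move=> A B; entrywise. Qed.
Lemma madd0 m : left_id (mzero m) (@madd m).
Proof. by move=> A; apply: mat_ext => i j; rewrite /madd /mzero; ring. Qed.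
HB.instance Definition _ m :=
  Monoid.isComLaw.Build (Mat m) (mzero m) (@madd m) (@maddA m) (@maddC m) (@madd0 m).

Lemma mmulA m (A B D : Mat m) : A ** (B ** D) = A ** B ** D.
Proof.
apply: mat_ext => i j; rewrite /mmul.
under eq_bigr => k _ do rewrite big_distrr /=.
rewrite exchange_big /=; apply: eq_bigr => l _.
by rewrite big_distrl /=; apply: eq_bigr => k _; ring.
Qed.

Lemma mmul1m m (A : Mat m) : mid m ** A = A.
Proof.
apply: mat_ext => i j; rewrite /mmul (bigD1 i) //= big1.
  by rewrite /mid eqxx; ring.
by move=> k /negbTE ki; rewrite /mid eq_sym ki; ring.
Qed.

Lemma mmulm1 m (A : Mat m) : A ** mid m = A.
Proof.
apply: mat_ext => i j; rewrite /mmul (bigD1 j) //= big1.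
  by rewrite /mid eqxx; ring.
by move=> k /negbTE kj; rewrite /mid kj; ring.
Qed.

Lemma mmulDl m (A B D : Mat m) : (A +m B) ** D = A ** D +m B ** D.
Proof.
apply: mat_ext => i j; rewrite /mmul /madd -big_split /=.
by apply: eq_bigr => k _; ring.
Qed.

Lemma mmulDr m (A B D : Mat m) : D ** (A +m B) = D ** A +m D ** B.
Proof.
apply: mat_ext => i j; rewrite /mmul /madd -big_split /=.
by apply: eq_bigr => k _; ring.
Qed.

Lemma mscale_mull m c (A B : Mat m) : mscale c A ** B = mscale c (A ** B).
Proof.
apply: mat_ext => i j; rewrite /mmul /mscale big_distrr /=.
by apply: eq_bigr => k _; ring.
Qed.

Lemma mscale_mulr m c (A B : Mat m) : A ** mscale c B = mscale c (A ** B).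
Proof.
apply: mat_ext => i j; rewrite /mmul /mscale big_distrr /=.
by apply: eq_bigr => k _; ring.
Qed.

Lemma mul0m m (A : Mat m) : mzero m ** A = mzero m.
Proof. by apply: mat_ext => i j; rewrite /mmul big1 // => k _; rewrite /mzero; ring. Qed.

Lemma mulm0 m (A : Mat m) : A ** mzero m = mzero m.
Proof. by apply: mat_ext => i j; rewrite /mmul big1 // => k _; rewrite /mzero; ring. Qed.

Lemma msubE m (A B : Mat m) : A -m B = A +m mscale (Copp C1) B.
Proof. by apply: mat_ext => i j; rewrite /msub /madd /mscale; ring. Qed.

Lemma mmulBl m (A B D : Mat m) : (A -m B) ** D = A ** D -m B ** D.
Proof. by rewrite !msubE mmulDl mscale_mull. Qed.

Lemma mmulBr m (A B D : Mat m) : D ** (A -m B) = D ** A -m D ** B.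
Proof. by rewrite !msubE mmulDr mscale_mulr. Qed.

Lemma msubK m (A B : Mat m) : A -m B +m B = A.
Proof. by apply: mat_ext => i j; rewrite /msub /madd; ring. Qed.

Lemma maddK m (A B : Mat m) : A +m B -m B = A.
Proof. by apply: mat_ext => i j; rewrite /msub /madd; ring. Qed.

Lemma msubrr m (A : Mat m) : A -m A = mzero m.
Proof. by apply: mat_ext => i j; rewrite /msub /mzero; ring. Qed.

Lemma msubr_eq0 m (A B : Mat m) : A -m B = mzero m -> A = B.
Proof.
by move=> h; rewrite -(msubK A B) h; apply: mat_ext => i j; rewrite /madd /mzero; ring.
Qed.

Lemma mscaleA m a b (A : Mat m) : mscale a (mscale b A) = mscale (Cmul a b) A.
Proof. by apply: mat_ext => i j; rewrite /mscale; ring. Qed.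

Lemma mscaleDr m c (A B : Mat m) : mscale c (A +m B) = mscale c A +m mscale c B.
Proof. by apply: mat_ext => i j; rewrite /mscale /madd; ring. Qed.

Lemma rscaleA m a b (A : Mat m) : rscale a (rscale b A) = rscale (a * b) A.
Proof. by entrywise. Qed.

Lemma rscale1 m (A : Mat m) : rscale 1 A = A.
Proof. by apply: mat_ext => i j; apply: Cmul1. Qed.

Lemma rscale0 m (A : Mat m) : rscale 0 A = mzero m.
Proof. by entrywise. Qed.

Lemma rscaleDl m a b (A : Mat m) : rscale (a + b) A = rscale a A +m rscale b A.
Proof. by entrywise. Qed.

Lemma mul_rscale m a b (A B : Mat m) : rscale a A ** rscale b B = rscale (a * b) (A ** B).
Proof. by rewrite /rscale mscale_mull mscale_mulr -/(rscale _ _) -/(rscale _ _) rscaleA. Qed.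

Lemma mpowSr m (A : Mat m) n : mpow A n ** A = A ** mpow A n.
Proof. by elim: n => [|n IH] /=; rewrite ?mmul1m ?mmulm1 // -mmulA IH. Qed.

Lemma mpowD m (A : Mat m) n p : mpow A (n + p) = mpow A n ** mpow A p.
Proof. by elim: n => [|n IH] /=; rewrite ?mmul1m // IH mmulA. Qed.

Lemma mpow_rscale m a (A : Mat m) n : mpow (rscale a A) n = rscale (a ^ n) (mpow A n).
Proof. by elim: n => [|n IH] /=; rewrite ?rscale1 // IH mul_rscale. Qed.

Lemma CconjM x y : Cconj (Cmul x y) = Cmul (Cconj x) (Cconj y).
Proof. by rewrite /Cconj /Cmul /=; congr pair; ring. Qed.

Lemma Cconj_sum (I : finType) (F : I -> C) :
  Cconj (\big[Cadd/C0]_i F i) = \big[Cadd/C0]_i Cconj (F i).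
Proof.
apply: (big_morph Cconj) => [x y|]; rewrite /Cconj /Cadd /C0 /=; congr pair; ring.
Qed.

Lemma mtrM m (A B : Mat m) : mtr (A ** B) = mtr B ** mtr A.
Proof. by apply: mat_ext => i j; apply: eq_bigr => k _; apply: CmulC. Qed.

Lemma mconjM m (A B : Mat m) : mconj (A ** B) = mconj A ** mconj B.
Proof.
by apply: mat_ext => i j; rewrite /mconj /mmul Cconj_sum; apply: eq_bigr => k _; apply: CconjM.
Qed.

Lemma madjM m (A B : Mat m) : madj (A ** B) = madj B ** madj A.
Proof. by rewrite /madj mtrM mconjM. Qed.

Lemma mtrK m (A : Mat m) : mtr (mtr A) = A. Proof. by []. Qed.
Lemma mconjK m (A : Mat m) : mconj (mconj A) = A.
Proof. by apply: mat_ext => i j; rewrite /mconj /Cconj /= Ropp_involutive -surjective_pairing. Qed.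
Lemma madjK m (A : Mat m) : madj (madj A) = A.
Proof. exact: mconjK. Qed.

Lemma mtr1 m : mtr (mid m) = mid m.
Proof. by apply: mat_ext => i j; rewrite /mtr /mid eq_sym. Qed.
Lemma mconj1 m : mconj (mid m) = mid m.
Proof.
apply: mat_ext => i j; rewrite /mconj /mid.
by case: ifP => _; rewrite /Cconj /C1 /C0 /= Ropp_0.
Qed.
Lemma madj1 m : madj (mid m) = mid m.
Proof. by rewrite /madj mtr1 mconj1. Qed.

Lemma unitary1 m : unitary (mid m).
Proof. by rewrite /unitary madj1 mmul1m. Qed.

Lemma unitaryM m (A B : Mat m) : unitary A -> unitary B -> unitary (A ** B).
Proof.
move=> [a1 a2] [b1 b2]; rewrite /unitary madjM; split.
  by rewrite mmulA -(mmulA (madj B)) a1 mmulm1.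
by rewrite mmulA -(mmulA A) b2 mmulm1.
Qed.

Lemma unitary_adj m (A : Mat m) : unitary A -> unitary (madj A).
Proof. by rewrite /unitary madjK => -[]. Qed.

(** * The entrywise sum norm *)

Lemma Cnorm_ge0 x : 0 <= Cnorm x. Proof. exact: sqrt_pos. Qed.
(** [Cnorm] and the operations on pairs unfold to Coquelicot's [Cmod] and complex operations, so
    facts about [Cmod] transfer by conversion. *)
Lemma Cnorm_triangle x y : Cnorm (Cadd x y) <= Cnorm x + Cnorm y.
Proof. exact: Complex.Cmod_triangle. Qed.
Lemma CnormM x y : Cnorm (Cmul x y) = Cnorm x * Cnorm y.
Proof. exact: Complex.Cmod_mult. Qed.
Lemma Cnorm_conj x : Cnorm (Cconj x) = Cnorm x.
Proof. by rewrite /Cnorm /=; congr sqrt; ring. Qed.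
Lemma Cnorm0 : Cnorm C0 = 0. Proof. exact: Complex.Cmod_0. Qed.
Lemma Cnorm1 : Cnorm C1 = 1. Proof. exact: Complex.Cmod_1. Qed.
Lemma CnormR a : Cnorm (RtoC a) = Rabs a. Proof. exact: Complex.Cmod_R. Qed.
Lemma Cnorm_opp x : Cnorm (Copp x) = Cnorm x. Proof. exact: Complex.Cmod_opp. Qed.
Lemma Cnorm_eq0 x : Cnorm x = 0 -> x = C0. Proof. exact: Complex.Cmod_eq_0. Qed.
Lemma Rabs_fst_le x : Rabs (fst x) <= Cnorm x.
Proof. exact: Rle_trans (Rmax_l _ _) (Complex.Rmax_Cmod x). Qed.
Lemma Rabs_snd_le x : Rabs (snd x) <= Cnorm x.
Proof. exact: Rle_trans (Rmax_r _ _) (Complex.Rmax_Cmod x). Qed.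
Lemma Cnorm_le x : Cnorm x <= Rabs (fst x) + Rabs (snd x).
Proof.
have -> : x = Cadd (RtoC (fst x)) (Cmul (RtoC (snd x)) Ci).
  by case: x => a b; rewrite /Cadd /Cmul /=; congr pair; ring.
apply: Rle_trans (Cnorm_triangle _ _) _.
rewrite CnormM !CnormR /=.
have -> : Cnorm Ci = 1 by rewrite /Cnorm /= -[RHS]sqrt_1; congr sqrt; ring.
by apply: Req_le; congr (Rabs _ + _); [ring | rewrite Rmult_1_r; congr Rabs; ring].
Qed.

Lemma sumR_ge0 (I : Type) (r : seq I) (P : pred I) (F : I -> R) :
  (forall i, 0 <= F i) -> 0 <= \big[Rplus/0]_(i <- r | P i) F i.
Proof. by move=> h; apply: big_ind => [|x y|//]; lra. Qed.

Lemma sumR_le (I : Type) (r : seq I) (P : pred I) (F G : I -> R) :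
  (forall i, P i -> F i <= G i) ->
  \big[Rplus/0]_(i <- r | P i) F i <= \big[Rplus/0]_(i <- r | P i) G i.
Proof. by move=> h; apply: (big_ind2 Rle) => [|a b c d|//]; lra. Qed.

Lemma term_le_sumR (I : finType) (F : I -> R) i :
  (forall i, 0 <= F i) -> F i <= \big[Rplus/0]_i F i.
Proof.
move=> h; rewrite (bigD1 i) //=.
have := sumR_ge0 (index_enum I) (fun j => j != i) h; lra.
Qed.

Lemma sumR_const n a : \big[Rplus/0]_(i < n) a = INR n * a.
Proof.
rewrite big_const_ord; elim: n => [|n IH]; first by rewrite /=; ring.
by rewrite iterS IH S_INR; ring.
Qed.

(** This norm is submultiplicative with constant 1, invariant under transposition and conjugation,
    and needs no supremum. The price is that the identity has norm m and unitary matrices are only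
    bounded. *)
Definition nrm m (A : Mat m) : R := \big[Rplus/0]_i \big[Rplus/0]_j Cnorm (A i j).

Lemma nrm_ge0 m (A : Mat m) : 0 <= nrm A.
Proof. by apply: sumR_ge0 => i; apply: sumR_ge0 => j; apply: Cnorm_ge0. Qed.

Lemma Cnorm_le_nrm m (A : Mat m) i j : Cnorm (A i j) <= nrm A.
Proof.
apply: Rle_trans (term_le_sumR (F := fun i => \big[Rplus/0]_j Cnorm (A i j)) i _).
  by apply: (term_le_sumR (F := fun j => Cnorm (A i j))) => ?; apply: Cnorm_ge0.
by move=> k; apply: sumR_ge0 => ?; apply: Cnorm_ge0.
Qed.

Lemma nrm_le m (A : Mat m) e :
  (forall i j, Cnorm (A i j) <= e) -> nrm A <= INR m * (INR m * e).
Proof.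
move=> h; rewrite -!sumR_const.
by apply: sumR_le => i _; apply: sumR_le => j _.
Qed.

Lemma nrm_eq0 m (A : Mat m) : nrm A <= 0 -> A = mzero m.
Proof.
move=> h; apply: mat_ext => i j; apply: Cnorm_eq0.
by have := Cnorm_le_nrm A i j; have := Cnorm_ge0 (A i j); lra.
Qed.

Lemma nrm0 m : nrm (mzero m) = 0.
Proof. by rewrite /nrm big1 // => i _; rewrite big1 // => j _; apply: Cnorm0. Qed.

Lemma nrmD m (A B : Mat m) : nrm (A +m B) <= nrm A + nrm B.
Proof.
rewrite -big_split /=; apply: sumR_le => i _; rewrite -big_split /=.
by apply: sumR_le => j _; apply: Cnorm_triangle.
Qed.

Lemma nrmZ m c (A : Mat m) : nrm (mscale c A) = Cnorm c * nrm A.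
Proof.
rewrite /nrm big_distrr /=; apply: eq_bigr => i _; rewrite big_distrr /=.
by apply: eq_bigr => j _; apply: CnormM.
Qed.

Lemma nrm_rscale m a (A : Mat m) : nrm (rscale a A) = Rabs a * nrm A.
Proof. by rewrite nrmZ CnormR. Qed.

Lemma nrmB m (A B : Mat m) : nrm (A -m B) <= nrm A + nrm B.
Proof.
rewrite msubE; apply: Rle_trans (nrmD _ _) _.
by rewrite nrmZ Cnorm_opp Cnorm1; lra.
Qed.

Lemma nrm_subC m (A B : Mat m) : nrm (A -m B) = nrm (B -m A).
Proof.
have -> : A -m B = mscale (Copp C1) (B -m A).
  by apply: mat_ext => i j; rewrite /msub /mscale; ring.
by rewrite nrmZ Cnorm_opp Cnorm1; ring.
Qed.

Lemma nrm_triangle m (B A D : Mat m) : nrm (A -m D) <= nrm (A -m B) + nrm (B -m D).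
Proof.
have -> : A -m D = (A -m B) +m (B -m D).
  by apply: mat_ext => i j; rewrite /msub /madd; ring.
exact: nrmD.
Qed.

Lemma nrm_sum m (I : Type) (r : seq I) (P : pred I) (F : I -> Mat m) :
  nrm (\big[@madd m/mzero m]_(i <- r | P i) F i) <= \big[Rplus/0]_(i <- r | P i) nrm (F i).
Proof.
apply: (big_ind2 (fun A x => nrm A <= x)) => [|A x B y hA hB|i _]; last exact: Rle_refl.
  by rewrite nrm0; lra.
by have := nrmD A B; lra.
Qed.

Lemma Cnorm_sum (I : Type) (r : seq I) (P : pred I) (F : I -> C) :
  Cnorm (\big[Cadd/C0]_(i <- r | P i) F i) <= \big[Rplus/0]_(i <- r | P i) Cnorm (F i).
Proof.
apply: (big_ind2 (fun A x => Cnorm A <= x)) => [|A x B y hA hB|i _]; last exact: Rle_refl.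
  by rewrite Cnorm0; lra.
by have := Cnorm_triangle A B; lra.
Qed.

Lemma nrmM m (A B : Mat m) : nrm (A ** B) <= nrm A * nrm B.
Proof.
rewrite {2}/nrm big_distrl /=; apply: sumR_le => i _.
apply: (@Rle_trans _ (\big[Rplus/0]_j \big[Rplus/0]_k (Cnorm (A i k) * Cnorm (B k j)))).
  apply: sumR_le => j _; apply: Rle_trans (Cnorm_sum _ _ _) _.
  by apply: sumR_le => k _; rewrite CnormM; apply: Rle_refl.
rewrite exchange_big /= big_distrl /=; apply: sumR_le => k _.
rewrite -big_distrr /=; apply: Rmult_le_compat_l; first exact: Cnorm_ge0.
apply: (term_le_sumR (F := fun k => \big[Rplus/0]_j Cnorm (B k j))) => l.
by apply: sumR_ge0 => j; apply: Cnorm_ge0.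
Qed.

Lemma nrm_tr m (A : Mat m) : nrm (mtr A) = nrm A.
Proof. by rewrite /nrm exchange_big. Qed.

Lemma nrm_conj m (A : Mat m) : nrm (mconj A) = nrm A.
Proof. by apply: eq_bigr => i _; apply: eq_bigr => j _; apply: Cnorm_conj. Qed.

Lemma nrm_adj m (A : Mat m) : nrm (madj A) = nrm A.
Proof. by rewrite /madj nrm_conj nrm_tr. Qed.

(** The squared moduli in a row of U add up to 1, so no entry exceeds 1 in modulus. That the bound
    depends on m alone is what keeps the step length in [multistep_log_step] independent of the
    number of factors. *)
Lemma unitary_nrm m (U : Mat m) : unitary U -> nrm U <= INR m * (INR m * 1).
Proof.
move=> [_ h]; apply: nrm_le => i j.
have h1 : \big[Rplus/0]_k (Cnorm (U i k) * Cnorm (U i k)) = 1.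
  have := f_equal (fun A : Mat m => fst (A i i)) h; rewrite /mmul /mid eqxx /=.
  rewrite (big_morph fst (id1 := 0) (op1 := Rplus)) // => <-; apply: eq_bigr => k _.
  by rewrite /Cnorm sqrt_sqrt /madj /mconj /mtr /Cconj /=; [ring | nra].
have := @term_le_sumR _ (fun k => Cnorm (U i k) * Cnorm (U i k)) j.
rewrite h1; have := Cnorm_ge0 (U i j) => h2 h3.
have : Cnorm (U i j) * Cnorm (U i j) <= 1 by apply: h3 => k; have := Cnorm_ge0 (U i k); nra.
nra.
Qed.

(** * The twist by epsilon *)

(** A multiplicative involution commuting with transposition and conjugation. Time-reversal symmetry
    becomes f(k) = twist of the transpose of f(-k), and condition (c) becomes, with this very
    bracketing, beta(-s, -k) = twist of the conjugate of beta(s, k). *)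
Definition twist m fer (A : Mat m) : Mat m := epsinv m fer ** (A ** epsm m fer).


Lemma half_add m : Nat.even m = true -> m = (Nat.div2 m + Nat.div2 m)%coq_nat.
Proof. by move=> /Nat.even_spec [k ->]; rewrite Nat.div2_double; lia. Qed.

Lemma Jmat_mul_tr m : Nat.even m = true -> Jmat m ** mtr (Jmat m) = mid m.
Proof.
move=> /half_add; set n := Nat.div2 m => hn.
(* Column k carries the single nonzero entry of row i of J, so the matrix product reduces to one
   term and the rest is index arithmetic. *)
have partner (i : 'I_m) : exists k : 'I_m,
    (val i < n)%coq_nat /\ val k = (val i + n)%coq_nat \/
    (n <= val i)%coq_nat /\ (val k + n)%coq_nat = val i.
  have /ltP hi := ltn_ord i; case: (Nat.lt_ge_cases (val i) n) => h.
    have hk : (val i + n < m)%nat by apply/ltP; move: h hi hn; rewrite -plusE /=; lia.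
    by exists (Ordinal hk); left.
  have hk : (val i - n < m)%nat by apply/ltP; move: h hi hn; rewrite -minusE /=; lia.
  exists (Ordinal hk); right; split=> //=; move: h hi hn; rewrite /= -minusE; lia.
apply: mat_ext => i j; rewrite /mmul /mtr.
have [k hk] := partner i.
rewrite (bigD1 k) //= big1; last first.
  move=> l /eqP lk; have h : val l <> val k by move=> /val_inj.
  rewrite {1}/Jmat -/n.
  case: Nat.ltb_spec => h1; case: Nat.eqb_spec => h2; try ring; exfalso; apply: h;
    move: hk h1 h2; rewrite /= -?plusE; lia.
have /ltP hi := ltn_ord i; have /ltP hj := ltn_ord j.
have hij : (i == j) = (val i == val j) by [].
rewrite /Jmat -/n /mid hij.
case: Nat.ltb_spec => h1; case: Nat.eqb_spec => h2;
  case: Nat.ltb_spec => h3; case: Nat.eqb_spec => h4; case: eqP => h5; try ring; exfalso;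
  move: hi hj hk h1 h2 h3 h4 h5; rewrite /= -?plusE; lia.
Qed.

Lemma mtr_Jmat m : Nat.even m = true -> mtr (Jmat m) = mscale (Copp C1) (Jmat m).
Proof.
move=> /half_add; set n := Nat.div2 m => hn.
apply: mat_ext => i j; rewrite /mtr /mscale /Jmat -/n.
have /ltP hi := ltn_ord i; have /ltP hj := ltn_ord j.
case: Nat.ltb_spec => h1; case: Nat.eqb_spec => h2;
  case: Nat.ltb_spec => h3; case: Nat.eqb_spec => h4; try ring; exfalso;
  move: hi hj h1 h2 h3 h4; rewrite /= -?plusE; lia.
Qed.

Lemma mconj_Jmat m : mconj (Jmat m) = Jmat m.
Proof.
apply: mat_ext => i j; rewrite /mconj /Jmat.
by case: Nat.ltb; case: Nat.eqb; rewrite /Cconj /Copp /C1 /C0 /= !Ropp_0.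
Qed.

Section Twist.
Variables (m : nat) (fer : bool).
Hypothesis hfer : fer = true -> Nat.even m = true.
Implicit Types A B : Mat m.

Lemma mtr_epsm : mtr (epsm m fer) = epsinv m fer.
Proof. by move: hfer; case: fer => h; rewrite /= ?mtr1 // mtr_Jmat ?h. Qed.

Lemma mconj_epsm : mconj (epsm m fer) = epsm m fer.
Proof. by case: fer; [apply: mconj_Jmat | apply: mconj1]. Qed.

Lemma eps_epsinv : epsm m fer ** epsinv m fer = mid m.
Proof.
rewrite -mtr_epsm; move: hfer; case: fer => h /=; last by rewrite mtr1 mmul1m.
by apply: Jmat_mul_tr; apply: h.
Qed.

Lemma epsinv_epsm : epsinv m fer ** epsm m fer = mid m.
Proof.
have := eps_epsinv; case: fer => /= h; last by rewrite mmul1m.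
by rewrite mscale_mull -mscale_mulr.
Qed.

Lemma mtr_epsinv : mtr (epsinv m fer) = epsm m fer.
Proof. by rewrite -mtr_epsm mtrK. Qed.

Lemma mconj_epsinv : mconj (epsinv m fer) = epsinv m fer.
Proof.
rewrite -mtr_epsm.
have -> : mconj (mtr (epsm m fer)) = mtr (mconj (epsm m fer)) by [].
by rewrite mconj_epsm.
Qed.

Lemma epsinvE : epsinv m fer = mscale (if fer then Copp C1 else C1) (epsm m fer).
Proof.
by case: fer => //=; apply: mat_ext => i j; rewrite /mscale; ring.
Qed.

Local Notation tw := (@twist m fer).

(* epsilon^-1 is a multiple of epsilon, so both conjugations agree. *)
Lemma twist_swap A : epsm m fer ** (A ** epsinv m fer) = tw A.
Proof. by rewrite /twist epsinvE mscale_mulr mscale_mulr mscale_mull. Qed.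

Lemma twistM A B : tw (A ** B) = tw A ** tw B.
Proof.
rewrite /twist !mmulA -(mmulA _ (epsm m fer)) eps_epsinv mmulm1.
by rewrite -!mmulA.
Qed.

Lemma twist1 : tw (mid m) = mid m.
Proof. by rewrite /twist mmul1m epsinv_epsm. Qed.

Lemma twistK A : tw (tw A) = A.
Proof.
rewrite -twist_swap /twist !mmulA eps_epsinv mmul1m -mmulA eps_epsinv.
by rewrite mmulm1.
Qed.

Lemma twist_tr A : mtr (tw A) = tw (mtr A).
Proof. by rewrite /twist !mtrM mtr_epsinv mtr_epsm -mmulA. Qed.

Lemma twist_conj A : mconj (tw A) = tw (mconj A).
Proof. by rewrite /twist !mconjM mconj_epsinv mconj_epsm. Qed.

Lemma twist_adj A : madj (tw A) = tw (madj A).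
Proof. by rewrite /madj twist_tr twist_conj. Qed.

Lemma twistD A B : tw (A +m B) = tw A +m tw B.
Proof. by rewrite /twist mmulDl mmulDr. Qed.

Lemma twistZ c A : tw (mscale c A) = mscale c (tw A).
Proof. by rewrite /twist mscale_mull mscale_mulr. Qed.

Lemma nrm_twist A : nrm (tw A) <= nrm (epsinv m fer) * nrm (epsm m fer) * nrm A.
Proof.
apply: Rle_trans (nrmM _ _) _; rewrite Rmult_assoc.
apply: Rmult_le_compat_l; first exact: nrm_ge0.
by rewrite Rmult_comm; apply: nrmM.
Qed.

Lemma tr_symP d (f : Vec d -> Mat m) :
  tr_sym (epsm m fer) f <-> forall k, f k = tw (mtr (f (vneg k))).
Proof.
split=> h k.
  by rewrite /twist -h mmulA epsinv_epsm mmul1m.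
by rewrite {1}h /twist !mmulA eps_epsinv mmul1m.
Qed.

End Twist.

(** * Limits along filters *)

(** One notion of limit serves series ([eventually]), continuity in k ([near_vec]) and joint
    continuity over a set of times ([near_pt]), so sums, products and exponentials are treated
    once. *)
Definition tends T m (F : (T -> Prop) -> Prop) (f : T -> Mat m) (A : Mat m) :=
  forall e, 0 < e -> F (fun x => nrm (f x -m A) < e).

Section Tends.
Variables (T : Type) (m : nat) (F : (T -> Prop) -> Prop).
Hypothesis FF : Hierarchy.Filter F.
Implicit Types (f g : T -> Mat m) (A B : Mat m).

Lemma tends_const A : tends F (fun _ => A) A.
Proof.
move=> e he; apply: Hierarchy.filter_imp Hierarchy.filter_true => x _.
by rewrite msubrr nrm0.
Qed.

Lemma tends_lip f g A B K :
  0 <= K -> F (fun x => nrm (f x -m A) <= K * nrm (g x -m B)) -> tends F g B -> tends F f A.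
Proof.
move=> hK hF hg e he.
have hd : 0 < e / (K + 1) by apply: Rdiv_lt_0_compat; lra.
apply: Hierarchy.filter_imp (Hierarchy.filter_and _ _ hF (hg _ hd)) => x [h1 h2].
have h3 : nrm (g x -m B) * (K + 1) < e.
  have -> : e = e / (K + 1) * (K + 1) by field; lra.
  by apply: Rmult_lt_compat_r; lra.
by have := nrm_ge0 (g x -m B); nra.
Qed.

Lemma tends_add f g A B :
  tends F f A -> tends F g B -> tends F (fun x => f x +m g x) (A +m B).
Proof.
move=> hf hg e he.
have hd : 0 < e / 2 by lra.
apply: Hierarchy.filter_imp (Hierarchy.filter_and _ _ (hf _ hd) (hg _ hd)) => x [h1 h2].
have -> : f x +m g x -m (A +m B) = (f x -m A) +m (g x -m B).
  by apply: mat_ext => i j; rewrite /madd /msub; ring.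
by have := nrmD (f x -m A) (g x -m B); lra.
Qed.

Lemma tends_mul f g A B :
  tends F f A -> tends F g B -> tends F (fun x => f x ** g x) (A ** B).
Proof.
move=> hf hg e he.
have ha := nrm_ge0 A; have hb := nrm_ge0 B.
(* If both errors are below some d <= 1, the three terms of the expansion below add up to at most d
   * (1 + nrm A + nrm B), which this choice keeps under e / 2. *)
have hd0 : 0 < e / (2 * (1 + nrm A + nrm B)) by apply: Rdiv_lt_0_compat; lra.
have hd : 0 < Rmin 1 (e / (2 * (1 + nrm A + nrm B))) by apply: Rmin_glb_lt; lra.
apply: Hierarchy.filter_imp (Hierarchy.filter_and _ _ (hf _ hd) (hg _ hd)) => x [].
set d := Rmin _ _ in hd * => h1 h2.
have d1 : d <= 1 by apply: Rmin_l.
have d2 : d * (1 + nrm A + nrm B) <= e / 2.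
  have -> : e / 2 = e / (2 * (1 + nrm A + nrm B)) * (1 + nrm A + nrm B) by field; lra.
  by apply: Rmult_le_compat_r; [lra | apply: Rmin_r].
have -> : f x ** g x -m A ** B =
    (f x -m A) ** (g x -m B) +m (A ** (g x -m B) +m (f x -m A) ** B).
  rewrite !mmulBl !mmulBr.
  by apply: mat_ext => i j; rewrite /madd /msub; ring.
have := nrmD ((f x -m A) ** (g x -m B)) (A ** (g x -m B) +m (f x -m A) ** B).
have := nrmD (A ** (g x -m B)) ((f x -m A) ** B).
have := nrmM (f x -m A) (g x -m B); have := nrmM A (g x -m B); have := nrmM (f x -m A) B.
have := nrm_ge0 (f x -m A); have := nrm_ge0 (g x -m B).
move: (nrm (f x -m A)) (nrm (g x -m B)) h1 h2 => u v hu hv.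
nra.
Qed.

Lemma tends_bounded_linear (phi : Mat m -> Mat m) K f A :
  (forall X Y, phi (X -m Y) = phi X -m phi Y) ->
  (forall X, nrm (phi X) <= K * nrm X) -> 0 <= K ->
  tends F f A -> tends F (fun x => phi (f x)) (phi A).
Proof.
move=> hl hb hK; apply: tends_lip hK _.
by apply: Hierarchy.filter_imp Hierarchy.filter_true => x _; rewrite -hl.
Qed.

Lemma tends_tr f A : tends F f A -> tends F (fun x => mtr (f x)) (mtr A).
Proof.
apply: (@tends_bounded_linear (@mtr m) 1) => // [X|]; last lra.
by rewrite nrm_tr; lra.
Qed.

Lemma tends_conj f A : tends F f A -> tends F (fun x => mconj (f x)) (mconj A).
Proof.
apply: (@tends_bounded_linear (@mconj m) 1) => [X Y|X|]; last lra.
  by entrywise.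
by rewrite nrm_conj; lra.
Qed.

Lemma tends_adj f A : tends F f A -> tends F (fun x => madj (f x)) (madj A).
Proof. by move=> /tends_tr /tends_conj. Qed.

Lemma tends_scale c f A : tends F f A -> tends F (fun x => mscale c (f x)) (mscale c A).
Proof.
apply: (@tends_bounded_linear (mscale c) (Cnorm c)) => [X Y|X|]; last exact: Cnorm_ge0.
  by rewrite !msubE mscaleDr !mscaleA (CmulC c).
by rewrite nrmZ; apply: Rle_refl.
Qed.

End Tends.

Lemma tends_unique T m (F : (T -> Prop) -> Prop) (FF : Hierarchy.ProperFilter' F)
    (f : T -> Mat m) A B : tends F f A -> tends F f B -> A = B.
Proof.
move=> hA hB; apply: msubr_eq0; apply: nrm_eq0; apply: Rnot_lt_le => h.
have hd : 0 < nrm (A -m B) / 2 by lra.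
have FF' := Hierarchy.filter_filter'.
apply: Hierarchy.filter_not_empty.
apply: Hierarchy.filter_imp (Hierarchy.filter_and _ _ (hA _ hd) (hB _ hd)) => x [].
by rewrite (nrm_subC (f x)) => h1 h2; have := nrm_triangle (f x) A B; lra.
Qed.

Lemma tends_nrm_le T m (F : (T -> Prop) -> Prop) (FF : Hierarchy.ProperFilter' F)
    (f : T -> Mat m) A c : F (fun x => nrm (f x) <= c) -> tends F f A -> nrm A <= c.
Proof.
move=> hc hA; apply: Rnot_lt_le => h.
have hd : 0 < nrm A - c by lra.
have FF' := Hierarchy.filter_filter'.
apply: Hierarchy.filter_not_empty.
apply: Hierarchy.filter_imp (Hierarchy.filter_and _ _ hc (hA _ hd)) => x [].
rewrite nrm_subC => h1 h2; have := nrmD (A -m f x) (f x).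
by rewrite msubK; lra.
Qed.

Local Notation tends_seq := (tends Hierarchy.eventually).
Lemma eventually_proper' : Hierarchy.ProperFilter' Hierarchy.eventually.
Proof. exact: Hierarchy.Proper_StrongProper. Qed.
Lemma eventually_filter' : Hierarchy.Filter Hierarchy.eventually.
Proof. exact: Hierarchy.filter_filter'. Qed.
Local Hint Resolve eventually_proper' eventually_filter' : core.

Lemma eventually_all (P : nat -> Prop) : (forall n, P n) -> Hierarchy.eventually P.
Proof. by exists 0%nat. Qed.

(** Majorant method: the increments of u are dominated by those of a convergent real sequence. It
    serves the exponential series and the fixed-point iteration for the logarithm. *)
Lemma tends_seq_complete m (u : nat -> Mat m) (s : nat -> R) l :
  (forall n, nrm (u n.+1 -m u n) <= s n.+1 - s n) -> Un_cv s l -> exists L, tends_seq u L.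
Proof.
move=> hu hs.
have hup n p : nrm (u (n + p)%nat -m u n) <= s (n + p)%nat - s n.
  elim: p => [|p IH]; first by rewrite addn0 msubrr nrm0; lra.
  rewrite addnS; have := hu (n + p)%nat.
  by have := nrm_triangle (u (n + p)%nat) (u (n + p).+1) (u n); lra.
have cauchy e : 0 < e -> exists N, forall n p, (N <= n)%coq_nat -> (N <= p)%coq_nat ->
    nrm (u n -m u p) < e.
  have := CV_Cauchy s (exist _ l hs) => hc he.
  have [N hN] := hc (e / 2) ltac:(lra).
  exists N => n p hn hp.
  have aux q : (N <= q)%coq_nat -> nrm (u q -m u N) < e / 2.
    move=> hq; have := hup N (q - N)%nat; have -> : (N + (q - N))%nat = q.
      by rewrite subnKC //; apply/leP.
    move=> h; have := hN q N hq (le_n N).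
    by rewrite /Rdist; have := Rle_abs (s q - s N); lra.
  have := nrm_triangle (u N) (u n) (u p).
  by have := aux n hn; have := aux p hp; rewrite (nrm_subC (u p)); lra.
(* Here g stands for the real or the imaginary part; both are additive and bounded by the modulus,
   so real completeness applies to each. *)
have entry (g : C -> R) i j : (forall x y, g x - g y = g (Cadd x (Copp y))) ->
    (forall x, Rabs (g x) <= Cnorm x) -> {x | Un_cv (fun n => g (u n i j)) x}.
  move=> gB gN; apply: R_complete => e he.
  have [N hN] := cauchy e he; exists N => n p hn hp.
  rewrite /Rdist gB; apply: Rle_lt_trans (gN _) _.
  exact: Rle_lt_trans (Cnorm_le_nrm (u n -m u p) i j) (hN _ _ hn hp).
have fstB x y : fst x - fst y = fst (Cadd x (Copp y)) by [].
have sndB x y : snd x - snd y = snd (Cadd x (Copp y)) by [].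
pose L : Mat m := fun i j =>
  (proj1_sig (entry _ i j fstB Rabs_fst_le), proj1_sig (entry _ i j sndB Rabs_snd_le)).
have limit (v : nat -> R) x a e N : Un_cv v x ->
    (forall p, (N <= p)%coq_nat -> Rabs (a - v p) <= e) -> Rabs (a - x) <= e.
  move=> hv ha; apply: Rnot_lt_le => h.
  have [N' hN'] := hv (Rabs (a - x) - e) ltac:(lra).
  have := hN' (N + N')%coq_nat ltac:(lia); have := ha (N + N')%coq_nat ltac:(lia).
  rewrite /Rdist.
  have := Rabs_triang (a - v (N + N')%coq_nat) (v (N + N')%coq_nat - x).
  have -> : a - v (N + N')%coq_nat + (v (N + N')%coq_nat - x) = a - x by ring.
  lra.
exists L => e he.
have hm := pos_INR m.
pose e' := e / (2 * (INR m * INR m) + 1).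
have he' : 0 < e' by apply: Rdiv_lt_0_compat; nra.
have [N hN] := cauchy _ he'; exists N => n hn.
have : nrm (u n -m L) <= INR m * (INR m * (e' + e')).
  apply: nrm_le => i j; apply: Rle_trans (Cnorm_le _) _.
  apply: Rplus_le_compat; rewrite /msub /=.
    have := proj2_sig (entry _ i j fstB Rabs_fst_le); set x := proj1_sig _ => hx.
    apply: (limit _ _ _ _ N hx) => p hp.
    apply: Rle_trans (Rabs_fst_le (Cadd (u n i j) (Copp (u p i j)))) _.
    exact: Rle_trans (Cnorm_le_nrm (u n -m u p) i j) (Rlt_le _ _ (hN _ _ hn hp)).
  have := proj2_sig (entry _ i j sndB Rabs_snd_le); set x := proj1_sig _ => hx.
  apply: (limit _ _ _ _ N hx) => p hp.
  apply: Rle_trans (Rabs_snd_le (Cadd (u n i j) (Copp (u p i j)))) _.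
  exact: Rle_trans (Cnorm_le_nrm (u n -m u p) i j) (Rlt_le _ _ (hN _ _ hn hp)).
have : e' * (2 * (INR m * INR m) + 1) = e by rewrite /e'; field; nra.
by nra.
Qed.

(** * The matrix exponential *)

Definition expser (x : R) n : R := \big[Rplus/0]_(i < n) (x ^ i / INR (fact i)).

Lemma expserS x n : expser x n.+1 = expser x n + x ^ n / INR (fact n).
Proof. by rewrite /expser big_ord_recr. Qed.

Lemma fact_pos n : 0 < / INR (fact n).
Proof. exact/Rinv_0_lt_compat/INR_fact_lt_0. Qed.

Lemma expser_cv x : Un_cv (expser x) (exp x).
Proof.
(* [E1 x n] includes the term of degree n, whereas [expser x n] stops before it. *)
have E n : expser x n.+1 = E1 x n.
  elim: n => [|n IH]; first by rewrite /expser big_ord_recr big_ord0 /E1 /=; field.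
  by rewrite expserS IH /E1 /=; congr (_ + _); apply: Rmult_comm.
move=> e he; have [N hN] := E1_cvg x e he; exists N.+1 => -[|n] hn; first by lia.
by rewrite E; apply: hN; lia.
Qed.

Lemma expser_incr x n : 0 <= x -> expser x n <= expser x n.+1.
Proof.
move=> hx; rewrite expserS /Rdiv.
by have := fact_pos n; have := pow_le x n hx; nra.
Qed.

Lemma expser_le x n : 0 <= x -> expser x n <= exp x.
Proof.
move=> hx; apply: (growing_ineq (expser x)); last exact: expser_cv.
by move=> k; apply: expser_incr.
Qed.

Lemma exp_partialS m (A : Mat m) n :
  exp_partial A n.+1 = exp_partial A n +m rscale (/ INR (fact n)) (mpow A n).
Proof. by []. Qed.

Lemma exp_partialE m (A : Mat m) n :
  exp_partial A n = \big[@madd m/mzero m]_(i < n) rscale (/ INR (fact i)) (mpow A i).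
Proof.
elim: n => [|n IH]; first by rewrite big_ord0.
by rewrite exp_partialS IH big_ord_recr.
Qed.

(** The prefactor accounts for n = 0, where the identity has norm m rather than 1. *)
Lemma nrm_mpow m (A : Mat m) n : nrm (mpow A n) <= (1 + nrm (mid m)) * nrm A ^ n.
Proof.
elim: n => [|n IH] /=; first by lra.
apply: Rle_trans (nrmM _ _) _; have := nrm_ge0 A => h.
by apply: Rle_trans (Rmult_le_compat_l _ _ _ h IH) _; apply: Req_le; ring.
Qed.

Lemma nrm_mpowS m (A : Mat m) n : nrm (mpow A n.+1) <= nrm A ^ n.+1.
Proof.
elim: n => [|n IH]; first by rewrite /= mmulm1; lra.
apply: Rle_trans (nrmM _ _) _.
by apply: Rmult_le_compat_l; [apply: nrm_ge0 | exact: IH].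
Qed.

Lemma is_mexpP m (A E : Mat m) : is_mexp A E <-> tends_seq (exp_partial A) E.
Proof.
have hm := pos_INR m; split=> h e he; last first.
  have [N hN] := h e he; exists N => n /leP hn i j.
  exact: Rle_lt_trans (Cnorm_le_nrm (exp_partial A n -m E) i j) (hN n hn).
pose e' := e / (INR m * INR m + 1).
have he' : 0 < e' by apply: Rdiv_lt_0_compat; nra.
have [N hN] := h _ he'; exists N => n /leP hn.
have : nrm (exp_partial A n -m E) <= INR m * (INR m * e').
  by apply: nrm_le => i j; apply: Rlt_le; apply: hN.
have : e' * (INR m * INR m + 1) = e by rewrite /e'; field; nra.
by nra.
Qed.

(** [mexp] is a choice and means nothing before convergence is known; the scalar series of [nrm A]
    is the majorant. *)
Lemma mexpP m (A : Mat m) : tends_seq (exp_partial A) (mexp A).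
Proof.
apply/is_mexpP; rewrite /mexp; apply: epsilon_spec.
pose c := 1 + nrm (mid m).
have [||E hE] := @tends_seq_complete m (exp_partial A)
  (fun n => c * expser (nrm A) n) (c * exp (nrm A)); last by exists E; apply/is_mexpP.
  move=> n; rewrite exp_partialS maddC maddK nrm_rscale expserS.
  rewrite Rabs_pos_eq; last exact: Rlt_le (fact_pos n).
  have := nrm_mpow A n; have := fact_pos n; rewrite -/c /Rdiv.
  by move: (nrm (mpow A n)) => v; nra.
move: (expser_cv (nrm A)) => hcv; apply: CV_mult => // e he.
by exists 0%nat => n _; rewrite /Rdist Rminus_diag Rabs_R0.
Qed.

Lemma mexp_unique m (A E : Mat m) : tends_seq (exp_partial A) E -> mexp A = E.
Proof. exact (@tends_unique _ _ _ eventually_proper' _ _ _ (mexpP A)). Qed.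

(** Only additivity and boundedness are asked of phi, so that the antilinear conjugation and the
    order-reversing transposition are covered along with the twist. *)
Lemma mexp_morph m (phi : Mat m -> Mat m) K (A B : Mat m) :
  (forall X Y, phi (X -m Y) = phi X -m phi Y) ->
  (forall X, nrm (phi X) <= K * nrm X) -> 0 <= K ->
  (forall n, phi (exp_partial A n) = exp_partial B n) -> phi (mexp A) = mexp B.
Proof.
move=> hl hb hK h; symmetry; apply: mexp_unique.
have -> : exp_partial B = fun n => phi (exp_partial A n) by apply: functional_extensionality.
exact: tends_bounded_linear hl hb hK (mexpP A).
Qed.

Lemma mexp_tr m (A : Mat m) : mexp (mtr A) = mtr (mexp A).
Proof.
symmetry; apply: (@mexp_morph m _ 1) => [X Y|X||n]; [by []|by rewrite nrm_tr; lra|lra|].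
have hp k : mtr (mpow A k) = mpow (mtr A) k.
  by elim: k => [|k IH] /=; rewrite ?mtr1 // mtrM IH mpowSr.
elim: n => [//|n IH]; rewrite !exp_partialS -IH -hp.
by apply: mat_ext.
Qed.

Lemma mexp_conj m (A : Mat m) : mexp (mconj A) = mconj (mexp A).
Proof.
symmetry; apply: (@mexp_morph m _ 1) => [X Y|X||n]; [|by rewrite nrm_conj; lra|lra|].
  by entrywise.
have hp k : mconj (mpow A k) = mpow (mconj A) k.
  by elim: k => [|k IH] /=; rewrite ?mconj1 // mconjM IH.
elim: n => [|n IH]; first by entrywise.
by rewrite !exp_partialS -IH -hp; entrywise.
Qed.

Lemma mexp_adj m (A : Mat m) : mexp (madj A) = madj (mexp A).
Proof. by rewrite /madj mexp_conj mexp_tr. Qed.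

Lemma mexp_twist m fer (hfer : fer = true -> Nat.even m = true) (A : Mat m) :
  mexp (twist fer A) = twist fer (mexp A).
Proof.
symmetry; apply: (mexp_morph (K := nrm (epsinv m fer) * nrm (epsm m fer))) => [X Y|||n].
- by rewrite !msubE twistD twistZ.
- exact: nrm_twist.
- by have := nrm_ge0 (epsinv m fer); have := nrm_ge0 (epsm m fer); nra.
have hp k : twist fer (mpow A k) = mpow (twist fer A) k.
  by elim: k => [|k IH] /=; rewrite ?twist1 // twistM // IH.
elim: n => [|n IH]; first by rewrite /= /twist mul0m mulm0.
by rewrite !exp_partialS -IH -hp twistD twistZ.
Qed.

(** Telescoping, one factor at a time. Exponents start at 1 because the zeroth power is not bounded
    by r^0 in this norm. *)
Lemma nrm_mpow_sub m (X Y : Mat m) r n : nrm X <= r -> nrm Y <= r ->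
  nrm (mpow X n.+1 -m mpow Y n.+1) <= INR n.+1 * r ^ n * nrm (X -m Y).
Proof.
move=> hX hY; elim: n => [|n IH]; first by rewrite /= !mmulm1; lra.
have -> : mpow X n.+2 -m mpow Y n.+2 =
    X ** (mpow X n.+1 -m mpow Y n.+1) +m (X -m Y) ** mpow Y n.+1.
  by rewrite mmulBl mmulBr /=; apply: mat_ext => i j; rewrite /madd /msub; ring.
apply: Rle_trans (nrmD _ _) _.
have h1 := nrmM X (mpow X n.+1 -m mpow Y n.+1).
have h2 := nrmM (X -m Y) (mpow Y n.+1).
have hr : 0 <= r by have := nrm_ge0 X; lra.
have h3 : nrm (mpow Y n.+1) <= r ^ n.+1.
  apply: Rle_trans (nrm_mpowS _ _) _; apply: pow_incr; split=> //; exact: nrm_ge0.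
have hn := pos_INR n.+1.
have h4 : nrm X * nrm (mpow X n.+1 -m mpow Y n.+1) <= r * (INR n.+1 * r ^ n * nrm (X -m Y)).
  by apply: Rmult_le_compat => //; apply: nrm_ge0.
have h5 : nrm (X -m Y) * nrm (mpow Y n.+1) <= nrm (X -m Y) * r ^ n.+1.
  by apply: Rmult_le_compat_l => //; apply: nrm_ge0.
rewrite (S_INR n.+1); have -> : r ^ n.+1 = r * r ^ n by [].
move: h5; have -> : r ^ n.+1 = r * r ^ n by [].
by move=> h5; lra.
Qed.

(* The constant [exp r - 1] vanishes with [r], so [e^X - X] contracts near 0. *)
Lemma mexp_sub_id_lip m (X Y : Mat m) r : nrm X <= r -> nrm Y <= r ->
  nrm ((mexp X -m X) -m (mexp Y -m Y)) <= (exp r - 1) * nrm (X -m Y).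
Proof.
move=> hX hY; have hr : 0 <= r by have := nrm_ge0 X; lra.
pose f Z n : Mat m := exp_partial Z n -m Z.
have hf Z : tends_seq (f Z) (mexp Z -m Z).
  rewrite /f msubE; have -> : (fun n => exp_partial Z n -m Z) =
      (fun n => exp_partial Z n +m mscale (Copp C1) Z).
    by apply: functional_extensionality => n; rewrite msubE.
  by apply: tends_add => //; [apply: mexpP | apply: tends_const].
apply: (@tends_nrm_le _ _ _ eventually_proper' (fun n => f X n -m f Y n)); last first.
  have -> : mexp X -m X -m (mexp Y -m Y) = mexp X -m X +m mscale (Copp C1) (mexp Y -m Y).
    by rewrite msubE.
  have -> : (fun n => f X n -m f Y n) = (fun n => f X n +m mscale (Copp C1) (f Y n)).
    by apply: functional_extensionality => n; rewrite msubE.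
  by apply: tends_add => //; apply: tends_scale.
(* With two terms [f Z 2] is the identity for every Z, so the difference starts at 0. Degree n+2
   then contributes at most r^(n+1) / (n+1)! times [nrm (X -m Y)], and these coefficients build up
   the series of exp r without its constant term. *)
have key n : nrm (f X n.+2 -m f Y n.+2) <= (expser r n.+1 - 1) * nrm (X -m Y).
  elim: n => [|n IH].
    have -> : f X 2%nat -m f Y 2%nat = mzero m.
      rewrite /f /= !mmulm1 /mscale /RtoC /madd /msub /mzero /mid.
      apply: mat_ext => i j; case: ifP => _;
        rewrite /Cadd /Cmul /Copp /C0 /C1 /=; congr pair; field.
    by rewrite nrm0 /expser big_ord_recr big_ord0 /=; apply: Req_le; field.
  have -> : f X n.+3 -m f Y n.+3 = (f X n.+2 -m f Y n.+2) +m
      rscale (/ INR (fact n.+2)) (mpow X n.+2 -m mpow Y n.+2).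
    rewrite /f !exp_partialS.
    by apply: mat_ext => i j; rewrite /madd /msub /rscale /mscale; ring.
  apply: Rle_trans (nrmD _ _) _; rewrite nrm_rscale (expserS r n.+1).
  rewrite Rabs_pos_eq; last exact: Rlt_le (fact_pos _).
  have h1 := nrm_mpow_sub n.+1 hX hY.
  have h2 : / INR (fact n.+2) * nrm (mpow X n.+2 -m mpow Y n.+2) <=
      r ^ n.+1 / INR (fact n.+1) * nrm (X -m Y).
    apply: Rle_trans (Rmult_le_compat_l _ _ _ (Rlt_le _ _ (fact_pos _)) h1) _.
    apply: Req_le; rewrite (fact_simpl n.+1) mult_INR; field.
    by split; [exact: INR_fact_neq_0 | exact: not_0_INR].
  by lra.
exists 2%nat => -[|[|n]] hn; try lia.
apply: Rle_trans (key n) _; apply: Rmult_le_compat_r; first exact: nrm_ge0.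
by have := expser_le n.+1 hr; lra.
Qed.

Lemma mexp_lip m (X Y : Mat m) r : nrm X <= r -> nrm Y <= r ->
  nrm (mexp X -m mexp Y) <= exp r * nrm (X -m Y).
Proof.
move=> hX hY; have := mexp_sub_id_lip hX hY.
have -> : mexp X -m mexp Y = ((mexp X -m X) -m (mexp Y -m Y)) +m (X -m Y).
  by apply: mat_ext => i j; rewrite /madd /msub; ring.
by move=> h; apply: Rle_trans (nrmD _ _) _; lra.
Qed.

Lemma tends_mexp T m (F : (T -> Prop) -> Prop) (FF : Hierarchy.Filter F) (f : T -> Mat m) A :
  tends F f A -> tends F (fun x => mexp (f x)) (mexp A).
Proof.
move=> hf; apply: (tends_lip (K := exp (nrm A + 1)) FF _ _ hf).
  exact: Rlt_le (exp_pos _).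
apply: Hierarchy.filter_imp (hf 1 Rlt_0_1) => x hx.
apply: mexp_lip; last lra.
by have := nrmD (f x -m A) A; rewrite msubK; lra.
Qed.

Lemma mexp0 m : mexp (mzero m) = mid m.
Proof.
apply: mexp_unique => e he; exists 1%nat => -[|n] hn; first by lia.
have -> : exp_partial (mzero m) n.+1 = mid m.
  elim: {hn} n => [|n IH].
    rewrite /= /RtoC /madd /mscale /mzero; apply: mat_ext => i j.
    by rewrite Rinv_1 -/C1; ring.
  rewrite exp_partialS IH /= mul0m.
  by apply: mat_ext => i j; rewrite /madd /rscale /mscale /mzero; ring.
by rewrite msubrr nrm0.
Qed.

(** * The one-parameter group law *)

(** The square is cut into the triangle i + j < n, regrouped along antidiagonals, and the opposite
    corner. An arbitrary commutative law is allowed because the same cut is made for matrices and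
    for the scalar majorant. *)
Lemma cauchy_split (V : Type) (idx : V) (op : Monoid.com_law idx) (F : nat -> nat -> V) n :
  \big[op/idx]_(i < n) \big[op/idx]_(j < n) F i j =
  op (\big[op/idx]_(k < n) \big[op/idx]_(i < k.+1) F i (k - i)%nat)
     (\big[op/idx]_(i < n) \big[op/idx]_(j < n | ~~ (i + j < n)%nat) F i j).
Proof.
rewrite (eq_bigr (fun i : 'I_n => op (\big[op/idx]_(j < n | (i + j < n)%nat) F i j)
    (\big[op/idx]_(j < n | ~~ (i + j < n)%nat) F i j))); last first.
  by move=> i _; rewrite (bigID (fun j : 'I_n => (i + j < n)%nat)).
rewrite big_split /=; congr (op _ _).
transitivity (\big[op/idx]_(k < n) \big[op/idx]_(i < n | (i <= k)%nat) F i (k - i)%nat); last first.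
  apply: eq_bigr => k _.
  rewrite [RHS](big_ord_widen n (fun i => F i (k - i)%nat)) //.
rewrite [RHS](exchange_big_dep xpredT) //=; apply: eq_bigr => i _.
transitivity (\big[op/idx]_(0 + i <= k < n) F i (k - i)%nat); last first.
  by rewrite add0n big_geq_mkord.
symmetry; rewrite big_addn big_mkord (big_ord_widen n (fun j => F i (j + i - i)%nat)) ?leq_subr //.
apply: eq_big => j; last by rewrite addnK.
by rewrite ltn_subRL.
Qed.

Definition expc (a : R) n := a ^ n / INR (fact n).

Lemma expc_add a b n : \big[Rplus/0]_(i < n.+1) (expc a i * expc b (n - i)%nat) = expc (a + b) n.
Proof.
have E (f : nat -> R) p : sum_f_R0 f p = \big[Rplus/0]_(i < p.+1) f i.
  elim: p => [|p IH]; first by rewrite big_ord_recr big_ord0 /=; ring.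
  by rewrite big_ord_recr -IH.
rewrite /expc binomial E /Rdiv big_distrl /=; apply: eq_bigr => i _.
rewrite /Binomial.C /Rdiv -minusE; field.
by repeat split; apply: INR_fact_neq_0.
Qed.

Lemma exp_partial_rscale m a (X : Mat m) n :
  exp_partial (rscale a X) n = \big[@madd m/mzero m]_(i < n) rscale (expc a i) (mpow X i).
Proof.
rewrite exp_partialE; apply: eq_bigr => i _.
by rewrite mpow_rscale rscaleA /expc Rmult_comm.
Qed.

Lemma mmul_suml m (I : finType) (F : I -> Mat m) A :
  (\big[@madd m/mzero m]_i F i) ** A = \big[@madd m/mzero m]_i (F i ** A).
Proof. by apply: (big_morph (fun X => X ** A)) => [X Y|]; rewrite ?mmulDl ?mul0m. Qed.

Lemma mmul_sumr m (I : finType) (F : I -> Mat m) A :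
  A ** (\big[@madd m/mzero m]_i F i) = \big[@madd m/mzero m]_i (A ** F i).
Proof. by apply: (big_morph (fun X => A ** X)) => [X Y|]; rewrite ?mmulDr ?mulm0. Qed.

Lemma rscale_suml m (I : finType) (F : I -> R) (A : Mat m) :
  rscale (\big[Rplus/0]_i F i) A = \big[@madd m/mzero m]_i rscale (F i) A.
Proof. by apply: (big_morph (fun a => rscale a A)) => [x y|]; rewrite ?rscaleDl ?rscale0. Qed.

(* The error of the truncated Cauchy product only involves nonnegative
   coefficients, so it is dominated by its scalar counterpart. *)
Lemma mexp_add_rscale m a b (X : Mat m) :
  mexp (rscale a X) ** mexp (rscale b X) = mexp (rscale (a + b) X).
Proof.
pose F i j := rscale (expc a i * expc b j) (mpow X (i + j)).
pose x := nrm X; pose c := 1 + nrm (mid m).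
pose G i j := expc (Rabs a * x) i * expc (Rabs b * x) j.
pose err n := expser (Rabs a * x) n * expser (Rabs b * x) n - expser (Rabs a * x + Rabs b * x) n.
have hx : 0 <= x := nrm_ge0 X.
have hc : 0 <= c by have := nrm_ge0 (mid m); rewrite /c; lra.
have prodE n : exp_partial (rscale a X) n ** exp_partial (rscale b X) n =
    exp_partial (rscale (a + b) X) n +m
    \big[@madd m/mzero m]_(i < n) \big[@madd m/mzero m]_(j < n | ~~ (i + j < n)%nat) F i j.
  rewrite !exp_partial_rscale mmul_suml.
  transitivity (\big[@madd m/mzero m]_(i < n) \big[@madd m/mzero m]_(j < n) F i j).
    apply: eq_bigr => i _; rewrite mmul_sumr; apply: eq_bigr => j _.
    by rewrite mul_rscale -mpowD.
  rewrite cauchy_split /=; congr (_ +m _); apply: eq_bigr => k _.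
  rewrite -expc_add rscale_suml; apply: eq_bigr => i _.
  by rewrite /F subnKC // -ltnS.
have errE n : err n =
    \big[Rplus/0]_(i < n) \big[Rplus/0]_(j < n | ~~ (i + j < n)%nat) G i j.
  rewrite /err /expser big_distrl /=.
  have -> : \big[Rplus/0]_(i < n) ((Rabs a * x) ^ i / INR (fact i) *
      \big[Rplus/0]_(j < n) ((Rabs b * x) ^ j / INR (fact j))) =
      \big[Rplus/0]_(i < n) \big[Rplus/0]_(j < n) G i j.
    by apply: eq_bigr => i _; rewrite big_distrr.
  rewrite cauchy_split /= (eq_bigr (fun k : 'I_n => expc (Rabs a * x + Rabs b * x) k)).
    by rewrite /expc; ring.
  by move=> k _; apply: expc_add.
have bound n : nrm (exp_partial (rscale a X) n ** exp_partial (rscale b X) n -m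
    exp_partial (rscale (a + b) X) n) <= c * err n.
  rewrite prodE maddC maddK errE big_distrr /=.
  apply: Rle_trans (nrm_sum _ _ _) _; apply: sumR_le => i _.
  rewrite big_distrr /=; apply: Rle_trans (nrm_sum _ _ _) _; apply: sumR_le => j _.
  rewrite nrm_rscale.
  have -> : c * G i j = Rabs (expc a i * expc b j) * (c * x ^ (i + j)).
    rewrite /G /expc !Rpow_mult_distr !RPow_abs /Rdiv !Rabs_mult -plusE pow_add.
    by rewrite !(Rabs_pos_eq (/ _)); [ring | exact: Rlt_le (fact_pos _) ..].
  by apply: Rmult_le_compat_l; [apply: Rabs_pos | apply: nrm_mpow].
(* The scalar corner sum is the gap in the real functional equation, so [exp_plus] makes it vanish
   in the limit. *)
have err0 : Un_cv err 0.
  have -> : 0 = exp (Rabs a * x) * exp (Rabs b * x) - exp (Rabs a * x + Rabs b * x).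
    by rewrite exp_plus; ring.
  by apply: CV_minus; [apply: CV_mult|]; apply: expser_cv.
have P : tends_seq (fun n => exp_partial (rscale a X) n ** exp_partial (rscale b X) n)
    (mexp (rscale a X) ** mexp (rscale b X)).
  exact: (tends_mul eventually_filter' (mexpP _) (mexpP _)).
apply: (@tends_unique _ _ _ eventually_proper' _ _ _ P) => e he.
have [N hN] := err0 (e / (2 * (c + 1))) ltac:(apply: Rdiv_lt_0_compat; lra).
have [N' hN'] := mexpP (rscale (a + b) X) (e := e / 2) ltac:(lra).
exists (N + N')%nat => n; rewrite -plusE => hn.
have := hN n ltac:(lia); have := hN' n ltac:(lia); have := bound n.
rewrite /Rdist Rminus_0_r; have h0 := Rle_abs (err n) => h1 h2 h3.
have h4 : c * err n <= e / 2.
  have -> : e / 2 = (c + 1) * (e / (2 * (c + 1))) by field; lra.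
  have h5 : err n <= e / (2 * (c + 1)) by lra.
  apply: Rle_trans (Rmult_le_compat_l _ _ _ hc h5) _.
  by apply: Rmult_le_compat_r; [apply: Rlt_le; apply: Rdiv_lt_0_compat|]; lra.
have := nrm_triangle (exp_partial (rscale (a + b) X) n)
  (exp_partial (rscale a X) n ** exp_partial (rscale b X) n) (mexp (rscale (a + b) X)).
by lra.
Qed.

(** * The local inverse of the exponential *)

(** From e^(-1/4) >= 3/4 one gets e^(1/4) - 1 <= 1/3. Hence X |-> e^X - X contracts by 1/2 on the
    ball of radius 1/4, the radius used for all logarithms below. *)
Lemma exp_quarter : exp (/ 4) - 1 <= / 2.
Proof.
have h1 := exp_ineq1_le (- / 4); have h2 : exp (/ 4) * exp (- / 4) = 1.
  by rewrite -exp_plus Rplus_opp_r exp_0.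
have := exp_pos (/ 4); nra.
Qed.

(** Reverse triangle inequality against the contraction e^X - X. It gives both uniqueness of small
    logarithms and their Lipschitz dependence, with constant 2, on the matrix. *)
Lemma mexp_expand m (X Y : Mat m) : nrm X <= / 4 -> nrm Y <= / 4 ->
  nrm (X -m Y) <= 2 * nrm (mexp X -m mexp Y).
Proof.
move=> hX hY; have h1 := mexp_sub_id_lip hX hY.
have := nrmB (mexp X -m mexp Y) ((mexp X -m X) -m (mexp Y -m Y)).
have -> : mexp X -m mexp Y -m ((mexp X -m X) -m (mexp Y -m Y)) = X -m Y.
  by apply: mat_ext => i j; rewrite /msub; ring.
have := exp_quarter; have := nrm_ge0 (X -m Y); nra.
Qed.

Lemma mexp_inj m (X Y : Mat m) : nrm X <= / 4 -> nrm Y <= / 4 -> mexp X = mexp Y -> X = Y.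
Proof.
move=> hX hY h; apply: msubr_eq0; apply: nrm_eq0.
by have := mexp_expand hX hY; rewrite h msubrr nrm0; lra.
Qed.

(* Fixed point of the contraction X |-> 1 + W - (e^X - X). *)
Lemma mlog_exists m (W : Mat m) : nrm W <= / 8 ->
  exists X, nrm X <= 2 * nrm W /\ mexp X = mid m +m W.
Proof.
set w := nrm W => hw; have w0 : 0 <= w := nrm_ge0 W.
pose T (X : Mat m) := (mid m +m W) -m (mexp X -m X).
pose u n := ssrnat.iter n T (mzero m).
(* Partial sums of w + w/2 + w/4 + ...: the first iterate is W and each increment is at most half
   the previous one. The total 2w <= 1/4 keeps all iterates in the contraction ball, whence the
   bound 1/8 on [nrm W]. *)
pose s n := 2 * w * (1 - (/ 2) ^ n).
have hpow n : 0 < (/ 2) ^ n by apply: pow_lt; lra.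
have s_le n : s n <= 2 * w by rewrite /s; have := hpow n; nra.
have key n : nrm (u n) <= s n /\ nrm (u n.+1 -m u n) <= s n.+1 - s n.
  elim: n => [|n [IH1 IH2]].
    rewrite /= /T mexp0 /s nrm0; split; first by rewrite /=; lra.
    have -> : mid m +m W -m (mid m -m mzero m) -m mzero m = W.
      by apply: mat_ext => i j; rewrite /msub /madd /mzero; ring.
    by rewrite -/w /=; lra.
  have h1 : nrm (u n.+1) <= s n.+1.
    by have := nrmD (u n.+1 -m u n) (u n); rewrite msubK; lra.
  split=> //.
  have -> : u n.+2 -m u n.+1 = (mexp (u n) -m u n) -m (mexp (u n.+1) -m u n.+1).
    by rewrite /= -/(u n) /T; apply: mat_ext => i j; rewrite /msub /madd; ring.
  have b1 : nrm (u n) <= / 4 by have := s_le n; lra.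
  have b2 : nrm (u n.+1) <= / 4 by have := s_le n.+1; lra.
  apply: Rle_trans (mexp_sub_id_lip b1 b2) _.
  have -> : s n.+2 - s n.+1 = / 2 * (s n.+1 - s n) by rewrite /s /=; field.
  have := exp_quarter; move: IH2; rewrite (nrm_subC (u n.+1)).
  by have := nrm_ge0 (u n -m u n.+1); nra.
have s_cv : Un_cv s (2 * w * (1 - 0)).
  apply: CV_mult; first by move=> e he; exists 0%nat => n _; rewrite /Rdist Rminus_diag Rabs_R0.
  apply: CV_minus; first by move=> e he; exists 0%nat => n _; rewrite /Rdist Rminus_diag Rabs_R0.
  move=> e he; have [|N hN] := pow_lt_1_zero (/ 2) _ e he.
    by rewrite Rabs_pos_eq; lra.
  by exists N => n hn; rewrite /Rdist Rminus_0_r; apply: hN.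
have [L hL] := tends_seq_complete (fun n => proj2 (key n)) s_cv.
have FF := eventually_filter'.
exists L; split.
  apply: (@tends_nrm_le _ _ _ eventually_proper' _ _ _ _ hL).
  by apply: eventually_all => n; have := key n; have := s_le n; lra.
have hT : tends_seq (fun n => T (u n)) (T L).
  rewrite /T; have -> : (fun n => mid m +m W -m (mexp (u n) -m u n)) =
      (fun n => (mid m +m W) +m (u n +m mscale (Copp C1) (mexp (u n)))).
    by apply: functional_extensionality => n; apply: mat_ext => i j;
      rewrite /msub /madd /mscale; ring.
  have -> : mid m +m W -m (mexp L -m L) = (mid m +m W) +m (L +m mscale (Copp C1) (mexp L)).
    by apply: mat_ext => i j; rewrite /msub /madd /mscale; ring.
  apply: tends_add => //; first exact: tends_const.
  by apply: tends_add => //; apply: tends_scale => //; apply: tends_mexp.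
(* T (u n) is the next iterate, so this is the same sequence shifted by one. *)
have hS : tends_seq (fun n => T (u n)) L.
  by move=> e he; have [N hN] := hL e he; exists N => n hn; apply: (hN n.+1); lia.
have := tends_unique eventually_proper' hT hS; rewrite /T => E.
symmetry; apply: msubr_eq0; move: (msubrr L); rewrite -{1}E => <-.
by apply: mat_ext => i j; rewrite /msub /madd; ring.
Qed.

Lemma madj_rscale m a (A : Mat m) : madj (rscale a A) = rscale a (madj A).
Proof. by entrywise. Qed.

Lemma mexp_rscaleN m a (X : Mat m) : mexp (rscale a X) ** mexp (rscale (- a) X) = mid m.
Proof. by rewrite mexp_add_rscale Rplus_opp_r rscale0 mexp0. Qed.

Definition skew m (X : Mat m) := madj X = rscale (- 1) X.

Lemma skew_iZ m (h : Mat m) : selfadj h -> skew (mscale Ci h).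
Proof.
rewrite /skew => hh.
have -> : madj (mscale Ci h) = mscale (Copp Ci) (madj h) by entrywise.
by rewrite hh; entrywise.
Qed.

Lemma mexp_skew_adj m (X : Mat m) a : skew X -> madj (mexp (rscale a X)) = mexp (rscale (- a) X).
Proof.
by move=> hX; rewrite -mexp_adj madj_rscale hX rscaleA; congr (mexp (rscale _ _)); ring.
Qed.

Lemma mexp_skew_unitary m (X : Mat m) a : skew X -> unitary (mexp (rscale a X)).
Proof.
move=> hX; rewrite /unitary mexp_skew_adj // mexp_rscaleN.
by have := mexp_rscaleN (- a) X; rewrite Ropp_involutive.
Qed.

(** * Continuity of matrix-valued families *)

Definition near_vec d (k : Vec d) (Q : Vec d -> Prop) :=
  exists delta, 0 < delta /\ forall k', (forall i, Rabs (k' i - k i) < delta) -> Q k'.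

Definition near_pt d (P : R -> Prop) t (k : Vec d) (Q : R * Vec d -> Prop) :=
  exists delta, 0 < delta /\ forall t' k', P t' -> Rabs (t' - t) < delta ->
    (forall i, Rabs (k' i - k i) < delta) -> Q (t', k').

Lemma near_vec_filter d (k : Vec d) : Hierarchy.Filter (near_vec k).
Proof.
split=> [|P Q [a [a0 hP]] [b [b0 hQ]]|P Q h [a [a0 hP]]].
- by exists 1; split; [lra|].
- exists (Rmin a b); split; first exact: Rmin_glb_lt.
  move=> k' hk; split; [apply: hP | apply: hQ] => i;
    apply: Rlt_le_trans (hk i) _; [exact: Rmin_l | exact: Rmin_r].
- by exists a; split=> // k' hk; apply: h; apply: hP.
Qed.

Lemma near_pt_filter d P t (k : Vec d) : Hierarchy.Filter (near_pt P t k).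
Proof.
split=> [|A B [a [a0 hA]] [b [b0 hB]]|A B h [a [a0 hA]]].
- by exists 1; split; [lra|].
- exists (Rmin a b); split; first exact: Rmin_glb_lt.
  have hl := Rmin_l a b; have hr := Rmin_r a b.
  move=> t' k' hP ht hk; split; [apply: hA | apply: hB] => // [|i||i];
    try (by apply: Rlt_le_trans ht _); by apply: Rlt_le_trans (hk i) _.
- by exists a; split=> // t' k' hP ht hk; apply: h; apply: hA.
Qed.
Local Hint Resolve near_vec_filter near_pt_filter : core.

Lemma tends_mclose T m (F : (T -> Prop) -> Prop) (FF : Hierarchy.Filter F) (f : T -> Mat m) A :
  tends F f A <-> forall e, 0 < e -> F (fun x => mclose (f x) A e).
Proof.
have hm := pos_INR m; split=> h e he.
  apply: Hierarchy.filter_imp (h e he) => x hx i j.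
  exact: Rle_lt_trans (Cnorm_le_nrm (f x -m A) i j) hx.
pose e' := e / (INR m * INR m + 1).
have he' : 0 < e' by apply: Rdiv_lt_0_compat; nra.
apply: Hierarchy.filter_imp (h _ he') => x hx.
have : nrm (f x -m A) <= INR m * (INR m * e').
  by apply: nrm_le => i j; apply: Rlt_le; apply: hx.
have : e' * (INR m * INR m + 1) = e by rewrite /e'; field; nra.
by nra.
Qed.

Lemma continuous_vmP d m (f : Vec d -> Mat m) :
  continuous_vm f <-> forall k, tends (near_vec k) f (f k).
Proof.
split=> h k; first by apply/tends_mclose => // e he; apply: h.
by have /tends_mclose := h k; apply.
Qed.

Lemma continuous2P d m P (f : R -> Vec d -> Mat m) : continuous2 P f <->
  forall t k, P t -> tends (near_pt P t k) (fun x => f x.1 x.2) (f t k).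
Proof.
split=> h t k hP; first by apply/tends_mclose => // e he; apply: h.
by have /tends_mclose := h t k hP; apply.
Qed.

Lemma tends_near_vec d m P t (k : Vec d) (f : Vec d -> Mat m) A :
  tends (near_vec k) f A -> tends (near_pt P t k) (fun x => f x.2) A.
Proof. by move=> h e he; have [a [a0 ha]] := h e he; exists a; split=> // t' k' _ _; apply: ha. Qed.

(** Lipschitz changes of the time variable, as needed for integer shifts of the path and for t |->
    (1 - t)/2 and its negative. Dividing the radius by K + 1 serves the time and the space condition
    together. *)
Lemma near_pt_comp d (P P' : R -> Prop) t t0 (k : Vec d) (g : R -> R) K :
  (forall t', P t' -> P' (g t')) -> 0 <= K ->
  (forall t', P t' -> Rabs (g t' - t0) <= K * Rabs (t' - t)) ->
  forall Q, near_pt P' t0 k Q -> near_pt P t k (fun x => Q (g x.1, x.2)).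
Proof.
move=> hg hK hl Q [a [a0 ha]]; exists (a / (K + 1)).
have h0 : 0 < a / (K + 1) by apply: Rdiv_lt_0_compat; lra.
have h1 : a = a / (K + 1) * (K + 1) by field; lra.
move: (a / (K + 1)) h0 h1 => b h0 h1.
split=> // t' k' hP ht hk; apply: ha.
- exact: hg.
- have h2 := Rmult_le_compat_l K _ _ hK (Rlt_le _ _ ht).
  by have /= := hl t' hP; lra.
- have h3 := Rmult_le_pos _ _ hK (Rlt_le _ _ h0).
  by move=> i; have /= := hk i; lra.
Qed.

Lemma tends_rscale T m (F : (T -> Prop) -> Prop) (FF : Hierarchy.Filter F) (a : T -> R) a0
    (f : T -> Mat m) A : (forall e, 0 < e -> F (fun x => Rabs (a x - a0) < e)) ->
  tends F f A -> tends F (fun x => rscale (a x) (f x)) (rscale a0 A).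
Proof.
(* A varying scalar is turned into a matrix factor, so that [tends_mul] applies. *)
have E b (B : Mat m) : rscale b B = rscale b (mid m) ** B.
  by rewrite -{2}(rscale1 B) mul_rscale mmul1m Rmult_1_r.
move=> ha hf; rewrite E.
have -> : (fun x => rscale (a x) (f x)) = (fun x => rscale (a x) (mid m) ** f x).
  by apply: functional_extensionality => x; apply: E.
apply: tends_mul => // e he.
have hn := nrm_ge0 (mid m).
have he' : 0 < e / (nrm (mid m) + 1) by apply: Rdiv_lt_0_compat; lra.
apply: Hierarchy.filter_imp (ha _ he') => x hx.
have -> : rscale (a x) (mid m) -m rscale a0 (mid m) = rscale (a x - a0) (mid m) by entrywise.
have h1 : e = e / (nrm (mid m) + 1) * (nrm (mid m) + 1) by field; lra.
by rewrite nrm_rscale; have := Rabs_pos (a x - a0); nra.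
Qed.

(** * Logarithms of families close to the identity *)

Definition generator_family d m fer (h : Vec d -> Mat m) :=
  continuous_vm h /\ periodic h /\ (forall k, selfadj (h k)) /\ tr_sym (epsm m fer) h.

Lemma near_identity_log d m fer (hfer : fer = true -> Nat.even m = true) :
  exists2 eta, 0 < eta & forall g : Vec d -> Mat m, matching_family fer g ->
    (forall k, nrm (g k -m mid m) <= eta) ->
    exists h, generator_family fer h /\ forall k, g k = mexp (mscale Ci (h k)).
Proof.
pose K := nrm (epsinv m fer) * nrm (epsm m fer).
have hK : 0 <= K by apply: Rmult_le_pos; apply: nrm_ge0.
(* The factor 1/8 makes [mlog_exists] applicable; dividing by K + 1 keeps even the twist of a
   logarithm, of norm at most K * (2 * eta), inside the uniqueness radius 1/4. *)
pose eta := / 8 * / (K + 1).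
have hinv : 0 < / (K + 1) by apply: Rinv_0_lt_compat; lra.
have hinvK : / (K + 1) * (K + 1) = 1 by field; lra.
have eta0 : 0 < eta by rewrite /eta; lra.
have eta8 : eta <= / 8 by rewrite /eta; nra.
have etaK : K * (2 * eta) <= / 4 by rewrite /eta; nra.
exists eta => // g [gc [gp [gu /(tr_symP hfer) gs]]] gn.
have ex k : exists X, nrm X <= 2 * eta /\ mexp X = g k.
  have hk := gn k; have [|X [hX E]] := @mlog_exists m (g k -m mid m); first lra.
  by exists X; split; [lra | rewrite E maddC msubK].
pose X k := proj1_sig (constructive_indefinite_description _ (ex k)).
have nX k : nrm (X k) <= 2 * eta by rewrite /X; case: constructive_indefinite_description => Y [].
have eX k : mexp (X k) = g k by rewrite /X; case: constructive_indefinite_description => Y [].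
(* Skewness, symmetry and periodicity of X all follow by exhibiting another small logarithm of the
   same g(k). *)
have uniq Y k : nrm Y <= / 4 -> mexp Y = g k -> Y = X k.
  by move=> h1 h2; apply: mexp_inj => //; [have := nX k; lra | rewrite eX].
have skX k : skew (X k).
  (* The exponential of minus the adjoint of X(k) is the inverse of the adjoint of g(k), which is
     g(k) by unitarity. *)
  have E : rscale (- 1) (madj (X k)) = X k.
    apply: uniq; first by rewrite nrm_rscale nrm_adj Rabs_Ropp Rabs_R1; have := nX k; lra.
    have := mexp_rscaleN 1 (madj (X k)); rewrite rscale1 mexp_adj eX => h.
    by have [_ h2] := gu k; rewrite -(mmulm1 (g k)) -h mmulA h2 mmul1m.
  rewrite /skew -{2}E rscaleA.
  have -> : - 1 * - 1 = 1 by ring.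
  by rewrite rscale1.
have sX k : X k = twist fer (mtr (X (vneg k))).
  symmetry; apply: uniq.
    have := nrm_twist fer (mtr (X (vneg k))); rewrite nrm_tr -/K.
    by have := nX (vneg k); have := nrm_ge0 (X (vneg k)); nra.
  by rewrite mexp_twist // mexp_tr eX -gs.
(* h = -i X, so that i h = X; skewness of X becomes self-adjointness of h. *)
exists (fun k => mscale (Copp Ci) (X k)); split; last first.
  move=> k; rewrite -eX mscaleA; congr mexp.
  by rewrite -{1}(rscale1 (X k)) /rscale; congr mscale; rewrite /RtoC /Cmul /=; congr pair; ring.
split.
  apply/continuous_vmP => k; apply: tends_scale => //.
  apply: (tends_lip (K := 2) (near_vec_filter k) _ _ (proj1 (continuous_vmP g) gc k)).
    by lra.
  have hT := @Hierarchy.filter_true _ _ (near_vec_filter k).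
  apply: (@Hierarchy.filter_imp _ _ (near_vec_filter k) _ _ _ hT) => k' _.
  by rewrite -!eX; apply: mexp_expand; [have := nX k' | have := nX k]; lra.
split.
  move=> k n; congr mscale; apply: uniq; first by have := nX (vshift k n); lra.
  by rewrite eX gp.
split.
  move=> k; rewrite /selfadj.
  have -> : madj (mscale (Copp Ci) (X k)) = mscale Ci (madj (X k)) by entrywise.
  by rewrite skX; entrywise.
apply/tr_symP => // k.
have -> : mtr (mscale (Copp Ci) (X (vneg k))) = mscale (Copp Ci) (mtr (X (vneg k))) by [].
by rewrite twistZ -sX.
Qed.

(** * Symmetric products of exponentials *)

Fixpoint halfprod d m (h : nat -> Vec d -> Mat m) (l : nat) (s : R) (k : Vec d) : Mat m :=
  match l with
  | O => mexp (rscale (- s) (mscale Ci (h O k)))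
  | S l' => mexp (rscale (- s) (mscale Ci (h l k))) ** halfprod h l' s k
  end.

Section HalfProducts.
Variables (d m : nat) (fer : bool).
Hypothesis hfer : fer = true -> Nat.even m = true.
Variables (M : nat) (h : nat -> Vec d -> Mat m).
Hypothesis hgen : forall l, (l <= M)%nat -> generator_family fer (h l).

Lemma generator_skew l k : (l <= M)%nat -> skew (mscale Ci (h l k)).
Proof. by move=> /hgen [_ [_ [hs _]]]; apply: skew_iZ. Qed.

Lemma halfprod_unitary l s k : (l <= M)%nat -> unitary (halfprod h l s k).
Proof.
elim: l => [|l IH] hl /=; first by apply: mexp_skew_unitary; apply: generator_skew.
apply: unitaryM; first by apply: mexp_skew_unitary; apply: generator_skew.
by apply: IH; apply: ltnW.
Qed.

Lemma halfprod_periodic l s : (l <= M)%nat -> periodic (halfprod h l s).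
Proof.
move=> hl k n; elim: l hl => [|l IH] hl /=.
  by have [_ [hp _]] := hgen hl; rewrite hp.
by have [_ [hp _]] := hgen hl; rewrite hp IH // ltnW.
Qed.

Lemma halfprod_tends l P s k : (l <= M)%nat ->
  tends (near_pt P s k) (fun x => halfprod h l x.1 x.2) (halfprod h l s k).
Proof.
have factor p : (p <= M)%nat -> tends (near_pt P s k)
    (fun x => mexp (rscale (- x.1) (mscale Ci (h p x.2)))) (mexp (rscale (- s) (mscale Ci (h p k)))).
  move=> hp; have FF := near_pt_filter P s k.
  apply: tends_mexp => //; apply: tends_rscale => //.
    move=> e he; exists e; split=> // t' k' _ ht _ /=.
    by have -> : - t' - - s = - (t' - s) by [ring]; rewrite Rabs_Ropp.
  apply: tends_scale => //; apply: tends_near_vec.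
  by have [hc _] := hgen hp; move/continuous_vmP: hc; apply.
elim: l => [|l IH] hl /=; first exact: factor.
exact: (tends_mul (near_pt_filter P s k) (factor _ hl) (IH (ltnW hl))).
Qed.

Lemma halfprod_tends_vec l s k : (l <= M)%nat ->
  tends (near_vec k) (halfprod h l s) (halfprod h l s k).
Proof.
move=> hl e he; have [a [a0 ha]] := halfprod_tends (fun _ => True) s k hl he.
exists a; split=> // k' hk; apply: (ha s k') => //.
by rewrite Rminus_diag Rabs_R0.
Qed.

(** For one factor, symmetry and self-adjointness give h(-k) = twist of the conjugate of h(k), and
    the sign change of i under conjugation is absorbed by s |-> -s. The twist composed with
    conjugation keeps the order of factors, so the product follows. *)
Lemma halfprod_sym l s k : (l <= M)%nat ->
  halfprod h l (- s) (vneg k) = twist fer (mconj (halfprod h l s k)).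
Proof.
have factor p : (p <= M)%nat -> mexp (rscale (- - s) (mscale Ci (h p (vneg k)))) =
    twist fer (mconj (mexp (rscale (- s) (mscale Ci (h p k))))).
  move=> hp; have [_ [_ [hs /(tr_symP hfer) ht]]] := hgen hp.
  rewrite -mexp_conj -mexp_twist //; congr mexp; rewrite ht.
  have -> : vneg (vneg k) = k by apply: functional_extensionality => i; apply: Ropp_involutive.
  have -> : mtr (h p k) = mconj (h p k) by rewrite -{1}(hs k) /madj -[mtr (mconj _)]/(mconj (mtr _)) mtrK.
  have -> : mconj (rscale (- s) (mscale Ci (h p k))) =
      rscale (- - s) (mscale Ci (mconj (h p k))) by entrywise.
  by rewrite /rscale !twistZ.
elim: l => [|l IH] hl /=; first exact: factor.
by rewrite (factor _ hl) (IH (ltnW hl)) mconjM (twistM hfer).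
Qed.

(** The central exponential splits evenly between the two sides. The right half is the inverse of
    the path at 1/2, written as an adjoint since the path is unitary. *)
Lemma msprod_factor l k : (l <= M)%nat ->
  msprod h l k = halfprod h l (- / 2) k ** madj (halfprod h l (/ 2) k).
Proof.
elim: l => [|l IH] hl /=.
  rewrite mexp_skew_adj ?Ropp_involutive; last exact: generator_skew.
  rewrite mexp_add_rscale; have -> : / 2 + / 2 = 1 by field.
  by rewrite rscale1.
have E : mscale (0, / 2) (h l.+1 k) = rscale (/ 2) (mscale Ci (h l.+1 k)) by entrywise.
rewrite E (IH (ltnW hl)) madjM (mexp_skew_adj _ (generator_skew _ hl)) !Ropp_involutive.
by rewrite !mmulA.
Qed.

End HalfProducts.

(** Index 0 is the centre of the product: the new generator takes it, and the former central
    exponential becomes an outer factor, split into two halves. *)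
Definition prepend d m (g : Vec d -> Mat m) (h : nat -> Vec d -> Mat m) (l : nat) :=
  if l is l'.+1 then h l' else g.

Lemma msprod_prepend d m fer M (h : nat -> Vec d -> Mat m) g l k :
  (forall l, (l <= M)%nat -> generator_family fer (h l)) -> (l <= M)%nat ->
  msprod (prepend g h) l.+1 k =
  halfprod h l (- / 2) k ** (mexp (mscale Ci (g k)) ** madj (halfprod h l (/ 2) k)).
Proof.
move=> hgen.
have E p : mscale (0, / 2) (h p k) = rscale (/ 2) (mscale Ci (h p k)) by entrywise.
elim: l => [|l IH] hl.
  by rewrite /= E (mexp_skew_adj _ (generator_skew hgen _ hl)) !Ropp_involutive.
have -> : msprod (prepend g h) l.+2 k = mexp (mscale (0, / 2) (h l.+1 k)) **
    (msprod (prepend g h) l.+1 k ** mexp (mscale (0, / 2) (h l.+1 k))) by [].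
rewrite (IH (ltnW hl)) E /= madjM (mexp_skew_adj _ (generator_skew hgen _ hl)) !Ropp_involutive.
by rewrite !mmulA.
Qed.

(** eta is chosen before G0 and its logarithm, hence does not depend on the number M of factors;
    this is what allows the homotopy to be cut in advance. The factor c * c bounds
    [nrm (V k) * nrm (W k)] for arbitrary unitaries. *)
Lemma multistep_log_step d m fer (hfer : fer = true -> Nat.even m = true) :
  exists2 eta, 0 < eta & forall G0 G1 : Vec d -> Mat m,
    admits_multistep_log fer G0 -> matching_family fer G1 ->
    (forall k, nrm (G1 k -m G0 k) <= eta) -> admits_multistep_log fer G1.
Proof.
have [eta eta0 hlog] := near_identity_log d hfer.
pose c := INR m * (INR m * 1).
have hc : 0 <= c by rewrite /c; have := pos_INR m; nra.
have hd : 0 < / (c * c + 1) by apply: Rinv_0_lt_compat; nra.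
exists (eta * / (c * c + 1)); first by nra.
move=> G0 G1 [M [h [hgen h0]]] [gc [gp [gu gs]]] hG.
(* [W] denotes here the value of the path at 1/2, that is, the inverse of the right-hand factor of
   G0; hence g uses [W] itself and not its adjoint. *)
pose V := halfprod h M (- / 2); pose W := halfprod h M (/ 2).
have Vu k : unitary (V k) := halfprod_unitary hgen _ _ (leqnn M).
have Wu k : unitary (W k) := halfprod_unitary hgen _ _ (leqnn M).
have G0E k : G0 k = V k ** madj (W k) by rewrite h0; apply: (msprod_factor hgen).
pose g k := madj (V k) ** (G1 k ** W k).
have gm : matching_family fer g.
  split.
    apply/continuous_vmP => k; apply: tends_mul => //.
      by apply: tends_adj => //; apply: (halfprod_tends_vec hgen).
    apply: tends_mul => //; last exact: (halfprod_tends_vec hgen).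
    by move/continuous_vmP: gc; apply.
  split.
    by move=> k n; rewrite /g /V /W !(halfprod_periodic hgen) // gp.
  split.
    by move=> k; apply: unitaryM; [apply: unitary_adj | apply: unitaryM].
  apply/tr_symP => // k; move/(tr_symP hfer): gs => gs.
  (* The reflection k |-> -k exchanges the times -1/2 and 1/2. Transposing g(-k) therefore puts the
     two outer factors back in their original places. *)
  have V1 : V (vneg k) = twist fer (mconj (W k)) := halfprod_sym hfer hgen (/ 2) k (leqnn M).
  have W1 : W (vneg k) = twist fer (mconj (V k)).
    by have := halfprod_sym hfer hgen (- / 2) k (leqnn M); rewrite Ropp_involutive.
  rewrite /g !mtrM V1 W1.
  have -> : mtr (madj (twist fer (mconj (W k)))) = twist fer (W k).
    rewrite twist_adj // twist_tr //; congr twist.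
    by rewrite /madj mconjK; apply: mtrK.
  rewrite twist_tr // -[mtr (mconj (V k))]/(madj (V k)).
  rewrite (twistM hfer (_ ** mtr _)) (twistM hfer _ (mtr _)).
  by rewrite !(twistK hfer) -gs mmulA.
have near k : nrm (g k -m mid m) <= eta.
  have -> : g k -m mid m = madj (V k) ** ((G1 k -m G0 k) ** W k).
    rewrite mmulBl mmulBr G0E; congr (_ -m _).
    have [v1 _] := Vu k; have [w1 _] := Wu k.
    by rewrite -(mmulA (V k)) w1 mmulm1 v1.
  apply: Rle_trans (nrmM _ _) _; rewrite nrm_adj.
  have a1 := unitary_nrm (Vu k); have a2 := unitary_nrm (Wu k).
  have a3 := nrmM (G1 k -m G0 k) (W k); have a4 := hG k.
  rewrite -/c in a1 a2.
  have a5 : nrm (G1 k -m G0 k) * nrm (W k) <= eta * / (c * c + 1) * c.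
    by apply: Rmult_le_compat => //; apply: nrm_ge0.
  have a6 : nrm (V k) * nrm ((G1 k -m G0 k) ** W k) <= c * (eta * / (c * c + 1) * c).
    by apply: Rmult_le_compat => //; try apply: nrm_ge0; lra.
  have a7 : eta = eta * / (c * c + 1) * (c * c + 1) by field; nra.
  have a8 : 0 < eta * / (c * c + 1) by nra.
  by lra.
have [q [qgen qE]] := hlog g gm near.
exists M.+1, (prepend q h); split; first by case=> [|l] hl; [apply: qgen | apply: hgen].
move=> k; rewrite (msprod_prepend _ _ hgen (leqnn M)) -qE /g -/(V _) -/(W _).
have [_ v2] := Vu k; have [_ w2] := Wu k.
by rewrite !mmulA v2 mmul1m -mmulA w2 mmulm1.
Qed.

Lemma constant_log d m fer (hfer : fer = true -> Nat.even m = true) :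
  admits_multistep_log fer (fun _ : Vec d => mid m).
Proof.
exists 0%nat, (fun _ _ => mzero m); split=> [l _|k]; last first.
  rewrite /=; have -> : mscale Ci (mzero m) = mzero m by entrywise.
  by rewrite mexp0.
split; first by apply/continuous_vmP => k; apply: tends_const.
split; first by [].
split; first by move=> k; rewrite /selfadj; entrywise.
by apply/tr_symP => // k; rewrite /twist -[mtr _]/(mzero m) mul0m mulm0.
Qed.

(** * From a homotopy to a multi-step logarithm *)

(** Coquelicot's compactness statement concerns nested pairs; these maps carry vectors there and
    back. *)
Fixpoint Tn_of_vec n : Vec n -> Compactness.Tn n R :=
  if n is n'.+1 then fun v => (v ord0, Tn_of_vec (fun i => v (lift ord0 i))) else fun _ => tt.

Fixpoint vec_of_Tn n : Compactness.Tn n R -> Vec n :=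
  if n is n'.+1 then fun x i => if unlift ord0 i is Some j then vec_of_Tn x.2 j else x.1
  else fun _ _ => 0.

Lemma close_vec_of_Tn n e (v : Vec n) y :
  Compactness.close_n n e (Tn_of_vec v) y -> forall i, Rabs (v i - vec_of_Tn y i) < e.
Proof.
elim: n v y => [|n IH] v; first by move=> y _ [].
move=> [y1 y2] /= [h1 h2] i; case: unliftP => [j ->|->] //.
exact: IH h2 j.
Qed.

Lemma bounded_Tn_of_vec n (v : Vec n) : (forall i, 0 <= v i <= 1) ->
  Compactness.bounded_n n (Tn_of_vec (fun _ => 0)) (Tn_of_vec (fun _ => 1)) (Tn_of_vec v).
Proof. by elim: n v => [|n IH] v hv //=; split=> //; apply: IH. Qed.

Lemma reduce_to_cube d (k : Vec d) : exists k0 n, k = vshift k0 n /\ forall i, 0 <= k0 i <= 1.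
Proof.
exists (fun i => k i - IZR (Int_part (k i))), (fun i => Int_part (k i)); split.
  by apply: functional_extensionality => i; rewrite /vshift; ring.
by move=> i; have [] := base_Int_part (k i); lra.
Qed.

(** A Lebesgue-number argument on [0, 1] times the unit cube; periodicity extends the uniformity
    from the cube to all k. *)
Lemma uniform_in_time d m (H : R -> Vec d -> Mat m) eta : 0 < eta ->
  continuous2 (fun t => 0 <= t <= 1) H -> (forall t, 0 <= t <= 1 -> periodic (H t)) ->
  exists2 delta, 0 < delta & forall t t' k, 0 <= t <= 1 -> 0 <= t' <= 1 ->
    Rabs (t' - t) < delta -> nrm (H t' k -m H t k) <= eta.
Proof.
move=> eta0 /continuous2P hc hp.
(* The gauge is half a modulus of continuity, so that (t', k) is still controlled when (t, k) is
   within a of the centre and t' within a of t. It must be defined at every point, hence the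
   arbitrary value 1 for times outside [0, 1]. *)
have ex (x : Compactness.Tn d.+1 R) : exists a : posreal, 0 <= x.1 <= 1 ->
    forall t' k', 0 <= t' <= 1 -> Rabs (t' - x.1) < 2 * a ->
    (forall i, Rabs (k' i - vec_of_Tn x.2 i) < 2 * a) ->
    nrm (H t' k' -m H x.1 (vec_of_Tn x.2)) < eta / 2.
  case: (excluded_middle_informative (0 <= x.1 <= 1)) => hx; last first.
    by exists (mkposreal 1 Rlt_0_1).
  have [a [a0 ha]] := hc x.1 (vec_of_Tn x.2) hx (eta / 2) ltac:(lra).
  have a2 : 0 < a / 2 by lra.
  exists (mkposreal _ a2) => _ t' k' ht'; have -> : 2 * mkposreal _ a2 = a by rewrite /=; field.
  exact: (ha t' k' ht').
pose dl x := proj1_sig (constructive_indefinite_description _ (ex x)).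
have hdl x := proj2_sig (constructive_indefinite_description _ (ex x)).
have [delta hdelta] := Compactness.compactness_value d.+1
  (0, Tn_of_vec (fun _ : 'I_d => 0)) (1, Tn_of_vec (fun _ : 'I_d => 1)) dl.
exists delta; first exact: cond_pos.
move=> t t' k ht ht' htt.
have [k0 [n [-> hk0]]] := reduce_to_cube k; rewrite !hp //.
(* The covering statement is doubly negated, which is enough for a proof by contradiction. *)
apply: Rnot_lt_le => habs.
apply: (hdelta (t, Tn_of_vec k0)) => /=.
  by split=> //; apply: bounded_Tn_of_vec.
move=> [[t1 y] [[ht1 _] [[c1 c2] c3]]].
have := hdl (t1, y) ht1; rewrite -/(dl (t1, y)) /= => hh.
have c2' := close_vec_of_Tn c2.
have pos := cond_pos (dl (t1, y)).
have b1 : nrm (H t k0 -m H t1 (vec_of_Tn y)) < eta / 2.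
  by apply: hh => // [|i]; [lra | have := c2' i; lra].
have b2 : nrm (H t' k0 -m H t1 (vec_of_Tn y)) < eta / 2.
  apply: hh => // [|i]; last by have := c2' i; lra.
  have -> : t' - t1 = (t' - t) + (t - t1) by ring.
  by apply: Rle_lt_trans (Rabs_triang _ _) _; lra.
have := nrm_triangle (H t1 (vec_of_Tn y)) (H t' k0) (H t k0).
by rewrite (nrm_subC (H t1 _)); lra.
Qed.

Lemma multistep_log_of_homotopy d m fer (hfer : fer = true -> Nat.even m = true)
    (alpha : Vec d -> Mat m) :
  equiv_null_homotopic fer alpha -> admits_multistep_log fer alpha.
Proof.
move=> [H [hc [hm [h0 h1]]]].
have [eta eta0 step] := multistep_log_step d hfer.
have hp t : 0 <= t <= 1 -> periodic (H t) by move=> /hm [_ []].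
have [delta delta0 hu] := uniform_in_time eta0 hc hp.
have [N [hN N0]] := archimed_cor1 delta delta0.
have NR : 0 < INR N by apply: lt_0_INR.
have frac j : (j <= N)%nat -> 0 <= INR j / INR N <= 1.
  move=> /leP /le_INR hj; have := pos_INR j => j0; split.
    by apply: Rmult_le_pos => //; apply: Rlt_le; apply: Rinv_0_lt_compat.
  apply: (Rmult_le_reg_r (INR N)) => //.
  by have -> : INR j / INR N * INR N = INR j by [field; lra]; lra.
(* Time runs backwards, since the homotopy ends at the identity, where a logarithm is known. *)
suff main j : (j <= N)%nat -> admits_multistep_log fer (H (1 - INR j / INR N)).
  have := main N (leqnn N); have -> : 1 - INR N / INR N = 0 by field; lra.
  by have -> : H 0 = alpha by apply: functional_extensionality.
elim: j => [|j IH] hj.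
  have -> : H (1 - INR 0 / INR N) = fun _ => mid m.
    by apply: functional_extensionality => k; rewrite /Rdiv Rmult_0_l Rminus_0_r.
  exact: constant_log.
have f1 := frac _ hj; have f0 := frac _ (ltnW hj).
apply: (step _ _ (IH (ltnW hj))); first by apply: hm; lra.
move=> k; apply: hu; [lra | lra |].
have -> : 1 - INR j.+1 / INR N - (1 - INR j / INR N) = - / INR N.
  by rewrite S_INR; field; lra.
by rewrite Rabs_Ropp Rabs_pos_eq //; apply: Rlt_le; apply: Rinv_0_lt_compat.
Qed.

(** * From a multi-step logarithm to a path of frames *)

(** Negative powers use the adjoint, so this is the group power exactly when A is unitary, and no
    inverse matrix is needed. *)
Definition zpow m (A : Mat m) (n : Z) : Mat m :=
  match n with
  | Z0 => mid m
  | Zpos p => mpow A (Pos.to_nat p)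
  | Zneg p => mpow (madj A) (Pos.to_nat p)
  end.

Lemma zpow_nat m (A : Mat m) n : zpow A (Z.of_nat n) = mpow A n.
Proof. by case: n => [//|n]; rewrite /zpow /= SuccNat2Pos.id_succ. Qed.

Lemma zpow_opp m (A : Mat m) n : zpow A (- n) = zpow (madj A) n.
Proof. by case: n => [//|p|p] //=; rewrite madjK. Qed.

Lemma zpow_succ m (A : Mat m) n : unitary A ->
  zpow A (n + 1) = A ** zpow A n /\ zpow A (n + 1) = zpow A n ** A.
Proof.
move=> [h1 h2]; case: (Z_le_gt_dec 0 n) => hn.
  rewrite -(Z2Nat.id n hn); set p := Z.to_nat n.
  have -> : (Z.of_nat p + 1)%Z = Z.of_nat p.+1 by lia.
  by rewrite !zpow_nat /= mpowSr.
have -> : n = (- Z.of_nat (Z.to_nat (- n - 1)).+1)%Z by lia.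
set p := Z.to_nat _; have -> : (- Z.of_nat p.+1 + 1)%Z = (- Z.of_nat p)%Z by lia.
rewrite !zpow_opp !zpow_nat; split; first by rewrite /= mmulA h2 mmul1m.
by rewrite /= -mpowSr -mmulA h1 mmulm1.
Qed.

Lemma zpow_ind m (Q : Mat m -> Prop) A : Q (mid m) ->
  (forall B, Q B -> Q (A ** B)) -> (forall B, Q B -> Q (madj A ** B)) -> forall n, Q (zpow A n).
Proof.
by move=> h0 h1 h2 [|p|p] //=; elim: (Pos.to_nat p) => [//|n IH] /=; [apply: h1 | apply: h2].
Qed.

Lemma unitary_zpow m (A : Mat m) n : unitary A -> unitary (zpow A n).
Proof.
move=> hA; apply: zpow_ind => [|B|B]; first exact: unitary1.
  exact: unitaryM.
exact/unitaryM/unitary_adj.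
Qed.

Lemma zpow_twist_conj m fer (hfer : fer = true -> Nat.even m = true) (A : Mat m) n :
  zpow (twist fer (mconj A)) n = twist fer (mconj (zpow A n)).
Proof.
have mpowE (B : Mat m) p : mpow (twist fer (mconj B)) p = twist fer (mconj (mpow B p)).
  elim: p => [|p IH] /=; first by rewrite mconj1 (twist1 hfer).
  by rewrite IH mconjM (twistM hfer (mconj B)).
case: n => [|p|p] /=; first by rewrite mconj1 (twist1 hfer).
  exact: mpowE.
by rewrite (twist_adj hfer) -[madj (mconj A)]/(mconj (madj A)) mpowE.
Qed.

Lemma tends_zpow T m (F : (T -> Prop) -> Prop) (FF : Hierarchy.Filter F) (f : T -> Mat m) A n :
  tends F f A -> tends F (fun x => zpow (f x) n) (zpow A n).
Proof.
move=> hf; have hpow (g : T -> Mat m) B p : tends F g B -> tends F (fun x => mpow (g x) p) (mpow B p).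
  move=> hg; elim: p => [|p IH]; first exact: tends_const.
  exact: (tends_mul FF hg IH).
by case: n => [|p|p] /=; [apply: tends_const | apply: hpow | apply: hpow; apply: tends_adj].
Qed.

Section Frame.
Variables (d m : nat) (fer : bool).
Hypothesis hfer : fer = true -> Nat.even m = true.
Variables (alpha : Vec d -> Mat m) (M : nat) (h : nat -> Vec d -> Mat m).
Hypothesis halpha : matching_family fer alpha.
Hypothesis hgen : forall l, (l <= M)%nat -> generator_family fer (h l).
Hypothesis halphaE : forall k, alpha k = msprod h M k.

(** The branch of the extended path for |s - n| <= 1/2. Its formula makes sense for all s, so each
    branch is continuous everywhere and only the gluing remains. *)
Definition frame_cell n s k := zpow (madj (alpha k)) n ** halfprod h M (s - IZR n) k.
(* [up (s - 1/2)] is an integer nearest to [s]. *)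
Definition frame s k := frame_cell (up (s - / 2)) s k.

Let Vu s k : unitary (halfprod h M s k) := halfprod_unitary hgen s k (leqnn M).
Let au k : unitary (alpha k). Proof. by have [_ [_ [hu _]]] := halpha. Qed.

(** The product formula for alpha enters the construction here: alpha^-1 takes the start of the
    half-product path to its end, which makes consecutive cells agree. *)
Lemma adj_alpha_half k : madj (alpha k) ** halfprod h M (- / 2) k = halfprod h M (/ 2) k.
Proof.
rewrite halphaE (msprod_factor hgen) // madjM madjK -mmulA.
by have [-> _] := Vu (- / 2) k; rewrite mmulm1.
Qed.

Lemma frame_cell_glue n s k : s = IZR n + / 2 -> frame_cell n s k = frame_cell (n + 1) s k.
Proof.
move=> ->; rewrite /frame_cell plus_IZR.
have -> : IZR n + / 2 - IZR n = / 2 by ring.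
have -> : IZR n + / 2 - (IZR n + 1) = - / 2 by field.
have [_ ->] := zpow_succ n (unitary_adj (au k)).
by rewrite -mmulA adj_alpha_half.
Qed.

(** The cells are closed: at a half-integer either neighbour may serve. Both the reflection s |-> -s
    and the continuity proof rely on this freedom. *)
Lemma frameE n s k : Rabs (s - IZR n) <= / 2 -> frame s k = frame_cell n s k.
Proof.
move=> hs; rewrite /frame; set p := up _.
have [h1 h2] := archimed (s - / 2); rewrite -/p in h1 h2.
have h3 : s - IZR n <= / 2 := Rle_trans _ _ _ (Rle_abs _) hs.
have h4 : - (s - IZR n) <= / 2.
  by apply: Rle_trans (Rle_abs _) _; rewrite Rabs_Ropp.
have h5 : (p < n + 2)%Z by apply: lt_IZR; rewrite plus_IZR; lra.
have h6 : (n < p + 1)%Z by apply: lt_IZR; rewrite plus_IZR; lra.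
have [-> //|E] : p = n \/ p = (n + 1)%Z by lia.
rewrite E -frame_cell_glue //.
by move: h2; rewrite E plus_IZR; lra.
Qed.

Lemma frame_cell_tends n s k :
  tends (near_pt (fun _ => True) s k) (fun x => frame_cell n x.1 x.2) (frame_cell n s k).
Proof.
have [/continuous_vmP hc _] := halpha.
have FF := near_pt_filter (fun _ => True) s k.
apply: (tends_mul FF).
  by apply: tends_zpow => //; apply: tends_adj => //; exact: tends_near_vec (hc k).
move=> e he.
have hV := halfprod_tends hgen (fun _ => True) (s - IZR n) k (leqnn M) he.
apply: (near_pt_comp (g := fun t => t - IZR n) (K := 1) _ _ _ hV) => [//||t' _]; first lra.
have -> : t' - IZR n - (s - IZR n) = t' - s by ring.
by lra.
Qed.

Lemma frame_continuous : continuous2 (fun _ => True) frame.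
Proof.
apply/continuous2P => s k _ e he.
have [h1 h2] := archimed (s - / 2); set n := up (s - / 2) in h1 h2.
have FF := near_pt_filter (fun _ => True) s k.
have E0 : frame s k = frame_cell n s k by [].
have hn := frame_cell_tends n s k he; rewrite -E0 in hn.
(* By the choice of n, s lies in [n - 1/2, n + 1/2). The only boundary case is thus the left
   endpoint, where cells n - 1 and n meet and both limits are needed. *)
case: (Rle_lt_dec s (IZR n - / 2)) => hs.
  have Es : s = IZR (n - 1) + / 2 by rewrite minus_IZR; lra.
  have E1 : frame s k = frame_cell (n - 1) s k.
    by rewrite E0 (frame_cell_glue k Es) Z.sub_add.
  have hn1 := frame_cell_tends (n - 1) s k he; rewrite -E1 in hn1.
  have hnear : near_pt (fun _ => True) s k (fun x => Rabs (x.1 - s) < 1).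
    by exists 1; split; [lra | move=> t' k' _ ht _].
  apply: Hierarchy.filter_imp (Hierarchy.filter_and _ _ hnear (Hierarchy.filter_and _ _ hn hn1)).
  move=> [t' k'] /= [/Rabs_def2 [t1 t2] [q1 q2]].
  case: (Rle_lt_dec s t') => ht.
    by rewrite (@frameE n) //; apply: Rabs_le; lra.
  rewrite (@frameE (n - 1)) // minus_IZR; apply: Rabs_le; lra.
have hnear : near_pt (fun _ => True) s k (fun x => Rabs (x.1 - IZR n) <= / 2).
  exists (Rmin (s - (IZR n - / 2)) (IZR n + / 2 - s)); split.
    by apply: Rmin_glb_lt; lra.
  move=> t' k' _ /Rabs_def2 [t1 t2] _ /=.
  have r1 := Rmin_l (s - (IZR n - / 2)) (IZR n + / 2 - s).
  have r2 := Rmin_r (s - (IZR n - / 2)) (IZR n + / 2 - s).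
  by apply: Rabs_le; lra.
apply: Hierarchy.filter_imp (Hierarchy.filter_and _ _ hnear hn).
by move=> [t' k'] /= [q1 q2]; rewrite (@frameE n).
Qed.

Lemma up_cell s : Rabs (s - IZR (up (s - / 2))) <= / 2.
Proof. by have [h1 h2] := archimed (s - / 2); apply: Rabs_le; lra. Qed.

Lemma frame_unitary s k : unitary (frame s k).
Proof. by apply: unitaryM => //; apply/unitary_zpow/unitary_adj. Qed.

Lemma frame_periodic s : periodic (frame s).
Proof.
have [_ [hp _]] := halpha.
by move=> k n; rewrite /frame /frame_cell hp (halfprod_periodic hgen).
Qed.

(** Reflection sends cell n to cell -n. The half-product part is [halfprod_sym]; for the power part,
    alpha(-k) is the twist of the conjugate of alpha(k)^-1, so the sign change of the exponent is
    compensated. *)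
Lemma frame_sym s k : frame (- s) (vneg k) = twist fer (mconj (frame s k)).
Proof.
have [_ [_ [_ /(tr_symP hfer) hs]]] := halpha.
have hcell := up_cell s; set n := up (s - / 2) in hcell.
rewrite (frameE k hcell) (@frameE (- n)); last first.
  by rewrite opp_IZR -Rabs_Ropp; have -> : - (- s - - IZR n) = s - IZR n by ring.
rewrite /frame_cell mconjM (twistM hfer (mconj (zpow _ _))).
have -> : - s - IZR (- n) = - (s - IZR n) by rewrite opp_IZR; ring.
rewrite (halfprod_sym hfer hgen _ _ (leqnn M)) zpow_opp madjK hs.
have -> : vneg (vneg k) = k by apply: functional_extensionality => i; apply: Ropp_involutive.
rewrite -(zpow_twist_conj hfer); congr (zpow (twist _ _) _ ** _).
by rewrite /madj mconjK.
Qed.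

Lemma frame_step s k : alpha k = frame s k ** madj (frame (s + 1) k).
Proof.
have hcell := up_cell s; set n := up (s - / 2) in hcell.
rewrite (@frameE (n + 1) (s + 1)); last first.
  by rewrite plus_IZR; have -> : s + 1 - (IZR n + 1) = s - IZR n by ring.
have -> : frame_cell (n + 1) (s + 1) k = madj (alpha k) ** frame s k.
  rewrite (frameE k hcell) /frame_cell.
  have [-> _] := zpow_succ n (unitary_adj (au k)).
  by rewrite -mmulA plus_IZR; have -> : s + 1 - (IZR n + 1) = s - IZR n by ring.
by rewrite madjM madjK mmulA; have [_ ->] := frame_unitary s k; rewrite mmul1m.
Qed.

End Frame.

Lemma beta_of_multistep_log d m fer (hfer : fer = true -> Nat.even m = true)
    (alpha : Vec d -> Mat m) : matching_family fer alpha ->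
  admits_multistep_log fer alpha -> admits_beta fer alpha.
Proof.
move=> hm [M [h [hgen hE]]]; exists (frame alpha M h).
split; first by move=> s k; apply: (frame_unitary hm hgen).
split; first exact: (frame_continuous hm hgen hE).
split; first by move=> s; apply: (frame_periodic hm hgen).
split; first by move=> s k; apply: (frame_sym hfer hm hgen hE).
by move=> s k; apply: (frame_step hm hgen hE).
Qed.

(** * From a path of frames back to a homotopy *)

Lemma homotopy_of_beta d m fer (hfer : fer = true -> Nat.even m = true)
    (alpha : Vec d -> Mat m) : admits_beta fer alpha -> equiv_null_homotopic fer alpha.
Proof.
move=> [b [bu [bc [bp [bs bE]]]]].
(* The parameter is 1 - t because a null-homotopy is required to start at alpha and end at the
   identity. Taking times symmetric about 0 lets the transpose at -k exchange the two factors, as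
   time reversal demands. *)
pose H t k := b (- ((1 - t) / 2)) k ** madj (b ((1 - t) / 2) k).
have Hc : continuous2 (fun t => 0 <= t <= 1) H.
  apply/continuous2P => t k ht.
  have FF := near_pt_filter (fun t => 0 <= t <= 1) t k.
  have shift (g : R -> R) K : (forall t', Rabs (g t' - g t) <= K * Rabs (t' - t)) -> 0 <= K ->
      tends (near_pt (fun t => 0 <= t <= 1) t k) (fun x => b (g x.1) x.2) (b (g t) k).
    move=> hg hK e he.
    have hb := proj1 (continuous2P _ _) bc (g t) k I e he.
    by apply: (near_pt_comp _ hK _ hb) => t' _.
  have half u : Rabs (u / 2) = 1 * Rabs u / 2.
    by rewrite /Rdiv Rabs_mult (Rabs_pos_eq (/ 2)); lra.
  apply: (tends_mul FF); last apply: (tends_adj FF).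
    apply: (shift (fun t => - ((1 - t) / 2)) 1); last lra.
    move=> t'; have -> : - ((1 - t') / 2) - - ((1 - t) / 2) = (t' - t) / 2 by field.
    by rewrite half; have := Rabs_pos (t' - t); lra.
  apply: (shift (fun t => (1 - t) / 2) 1); last lra.
  move=> t'; have -> : (1 - t') / 2 - (1 - t) / 2 = - ((t' - t) / 2) by field.
  by rewrite Rabs_Ropp half; have := Rabs_pos (t' - t); lra.
exists H; split=> //; split; last split.
- move=> t ht; split.
    apply/continuous_vmP => k e he.
    have [a [a0 ha]] := proj1 (continuous2P _ _) Hc t k ht e he.
    by exists a; split=> // k' hk; apply: (ha t k') => //; rewrite Rminus_diag Rabs_R0.
  split; first by move=> k n; rewrite /H !bp.
  split; first by move=> k; apply: unitaryM => //; apply: unitary_adj.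
  apply/(tr_symP hfer) => k; rewrite /H; set s := (1 - t) / 2.
  have hb r : b r (vneg k) = twist fer (mconj (b (- r) k)).
    by rewrite -{1}(Ropp_involutive r); apply: bs.
  rewrite mtrM !hb Ropp_involutive.
  have -> : mtr (madj (twist fer (mconj (b (- s) k)))) = twist fer (b (- s) k).
    rewrite (twist_adj hfer) (twist_tr hfer); congr twist.
    by rewrite /madj mconjK; apply: mtrK.
  rewrite (twist_tr hfer) -[mtr (mconj _)]/(madj (b s k)).
  by rewrite (twistM hfer (twist _ _)) !(twistK hfer).
- move=> k; rewrite /H.
  (* Condition (d) at k1 = -1/2. *)
  have -> : - ((1 - 0) / 2) = - / 2 by field.
  have -> : (1 - 0) / 2 = - / 2 + 1 by field.
  by rewrite -bE.
- move=> k; rewrite /H.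
  have -> : - ((1 - 1) / 2) = 0 by field.
  have -> : (1 - 1) / 2 = 0 by field.
  by have [_ ->] := bu 0 k.
Qed.

Theorem theorem2p4 (d m : nat) (fer : bool)
  (hd : (1 <= d)%nat) (hm : (1 <= m)%nat) (hfer : fer = true -> Nat.even m = true)
  (alpha : Vec d -> Mat m) (halpha : matching_family fer alpha) :
  (equiv_null_homotopic fer alpha <-> admits_multistep_log fer alpha) /\
  (admits_multistep_log fer alpha <-> admits_beta fer alpha).
Proof.
have h12 := @multistep_log_of_homotopy d m fer hfer alpha.
have h23 := beta_of_multistep_log hfer halpha.
have h31 := @homotopy_of_beta d m fer hfer alpha.
by split; split=> h; auto.
Qed.
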